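(* Let $p$ be a prime, $s\ge 1$, $R=\mathbb{Z}_{p^s}$, and let $n\geq 2m\geq 4$. Let $\varphi$ be an automorphism of the Grassmann graph $G_{p^s}(n,m)$. Then either there exists $U\in GL_n(\mathbb{Z}_{p^s})$ such that $\varphi(X)=XU$ for all vertices $X$ of $G_{p^s}(n,m)$; or $n=2m$ and there exists $U\in GL_n(\mathbb{Z}_{p^s})$ such that $\varphi(X)=(XU)^\perp$ for all vertices $X$ of $G_{p^s}(2m,m)$.
   Context: $R=\mathbb{Z}_{p^s}$ is the ring of integers modulo $p^s$; vectors are row vectors in $R^n$. A set $\{\alpha_1,\dots,\alpha_k\}\subseteq R^n$ is unimodular if the $k\times n$ matrix with rows $\alpha_i$ has a right inverse over $R$. For an $R$-submodule (linear subset) $V\subseteq R^n$, $\dim(V)$ is the largest number of vectors in a unimodular subset of $V$. A $k$-subspace ($k\ge1$) of $R^n$ is a submodule having a unimodular basis of $k$ vectors; the $0$-subspace is $\{0\}$. A $k$-subspace $X$ is identified with a matrix representation, i.e. a $k\times n$ matrix whose rows form such a basis (unique up to left multiplication by $GL_k(R)$); for $U\in GL_n(R)$, $XU$ denotes the subspace spanned by the rows of (representation of $X$)$\cdot U$. The dual of a subspace $P$ is $P^\perp=\{y\in R^n: y\,{}^tx=0 \text{ for all } x\in P\}$ (for an $m$-subspace $P$ it is an $(n-m)$-subspace). For $1\le m<n$, the Grassmann graph $G_{p^s}(n,m)$ has as vertices all $m$-subspaces of $R^n$, two vertices $A,B$ being adjacent iff $A\cap B$ is a linear subset of dimension $m-1$.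 *)

(* Defs.v *)
From HB Require Import structures.
From mathcomp Require Import all_boot all_order all_algebra.

Set Implicit Arguments.
Unset Strict Implicit.
Unset Printing Implicit Defensive.

Import GRing.Theory.
Local Open Scope ring_scope.

Section GrassmannGraph.

Variables (R : finComUnitRingType) (n : nat).

Definition unimodular k (M : 'M[R]_(k, n)) : bool :=
  [exists N : 'M[R]_(n, k), M *m N == 1%:M].

(* The order in which the vectors of S are listed as rows is irrelevant:
   permuting the rows preserves the existence of a right inverse. *)
Definition unimodular_set (S : {set 'rV[R]_n}) : bool :=
  unimodular (\matrix_(i < #|S|) (enum_val i : 'rV[R]_n)).

Definition dim (V : {set 'rV[R]_n}) : nat :=
  \max_(S : {set 'rV[R]_n} | (S \subset V) && unimodular_set S) #|S|.

(* mathcomp's row spaces (%MS) are only available over fields. *)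
Definition rowspan k (M : 'M[R]_(k, n)) : {set 'rV[R]_n} :=
  [set u *m M | u : 'rV[R]_k].

Definition lin_indep k (M : 'M[R]_(k, n)) : bool :=
  [forall u : 'rV[R]_k, (u *m M == 0) ==> (u == 0)].

Definition represents k (M : 'M[R]_(k, n)) (X : {set 'rV[R]_n}) : bool :=
  [&& unimodular M, lin_indep M & X == rowspan M].

(* For k = 0 the only instance is X = [set 0]. *)
Definition is_subspace k (X : {set 'rV[R]_n}) : bool :=
  [exists M : 'M[R]_(k, n), represents M X].

Definition dual (P : {set 'rV[R]_n}) : {set 'rV[R]_n} :=
  [set y : 'rV[R]_n | [forall x in P, y *m x^T == 0]].

Definition grassmann_vertex (m : nat) : Type :=
  {X : {set 'rV[R]_n} | is_subspace m X}.

(* The intersection of two subspaces is always a submodule, though in general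
   not a subspace; for 0 < m, no vertex is adjacent to itself. *)
Definition grassmann_adj (m : nat) (A B : grassmann_vertex m) : bool :=
  dim (val A :&: val B) == m.-1.

Definition grassmann_automorphism (m : nat)
    (phi : grassmann_vertex m -> grassmann_vertex m) : Prop :=
  bijective phi /\
  forall A B, grassmann_adj (phi A) (phi B) = grassmann_adj A B.

End GrassmannGraph.

Arguments grassmann_vertex R n m : clear implicits.

(* Main.v *)
Require Import Defs.
From HB Require Import structures.
From mathcomp Require Import all_boot all_order all_algebra all_field.
From mathcomp Require Import zify.
Import GRing.Theory.
Local Open Scope ring_scope.

Set Implicit Arguments.
Unset Strict Implicit.
Unset Printing Implicit Defensive.

(** A star is the set of vertices containing a fixed (m-1)-subspace, a top the set
of vertices inside a fixed (m+1)-subspace; both are cliques.  Three pairwise adjacent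
vertices that are distinct modulo p and do not belong to a pencil modulo p already
determine a star or a top containing every further member of their clique.  A clique
all of whose members are congruent modulo p has at most p^((s-1)(n-m)) elements:
in coordinates its members differ by matrices c r, and a linear map built from the
multiplication of the field of order p^(n-m) separates them.  Hence a clique lying in
a pencil modulo p is smaller than a star, and an automorphism sends stars to stars or,
if n = 2m, all stars to tops; composition with duality reduces the second case to the
first.  A star-preserving automorphism induces an automorphism of the graph of
(m-1)-subspaces, and by descent a bijection of the points preserving lines.  The
fundamental theorem of projective geometry makes it linear, because every element of
the ring of integers modulo p^s is a sum of ones. *)

(** The incidence arguments separate vertices that differ modulo p and say nothing about congruent
    ones, whose common (m-1)-subspace may fail to be unique. Cliques of congruent vertices are
    therefore only bounded in size, and the type of a clique is recovered by counting. Put r =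
    p^((s-1)(n-m)). A star has r (p^(n-m+1) - 1)/(p - 1) members. A pencil modulo p has p + 1
    points, so a clique over it has at most (p + 1) r members, and m >= 2 with n >= 2m gives n - m +
    1 >= 3, which makes the star larger. The map behind the bound r combines the m rows of a matrix
    into one by m independent multiplications, available since m <= n - m. A top has p^((s-1)m)
    (p^(m+1) - 1)/(p - 1) members, hence can contain as many as a star only for n = 2m. *)

(* A finite local ring with residue field F_p and principal, nilpotent maximal ideal;
   rlift is any section of the residue map, not a morphism. *)
Record chainRing := ChainRing {
  chain_sort :> finComUnitRingType;
  chain_char : nat;
  chain_char_prime : prime chain_char;
  red : {rmorphism chain_sort -> 'F_chain_char};
  rlift : 'F_chain_char -> chain_sort;
  rliftK : cancel rlift red;
  red_unit : forall x, red x != 0 -> x \is a GRing.unit;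
  unif : chain_sort;
  len : nat;
  red_eq0 : forall x, red x = 0 -> exists y, x = unif * y;
  unif_nilp : unif ^+ len = 0
}.

Notation "''k' K" := 'F_(chain_char K) (at level 8, K at level 2, format "''k' K").
Notation "M ^r" := (map_mx (red _) M) (at level 2, format "M ^r").

(** * Linear algebra over a local ring by reduction to the residue field *)

Section LocalRing.

Variable K : chainRing.

Lemma unitr_red (x : K) : (x \is a GRing.unit) = (red K x != 0).
Proof.
apply/idP/idP; last exact: red_unit.
by move=> /(rmorph_unit (red K)); rewrite unitfE.
Qed.

Lemma unitmx_red k (A : 'M[K]_k) : (A \in unitmx) = (A^r \in unitmx).
Proof. by rewrite !unitmxE det_map_mx unitr_red unitfE. Qed.

Lemma rlift_mxK m k (A : 'M['k K]_(m, k)) : (map_mx (@rlift K) A)^r = A.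
Proof. by apply/matrixP=> i j; rewrite !mxE rliftK. Qed.

Lemma red_mx0P m k (A : 'M[K]_(m, k)) :
  A^r = 0 -> exists B : 'M_(m, k), A = unif K *: B.
Proof.
move=> A0; have D (x : K) : exists y, (red K x == 0) ==> (x == unif K * y).
  have [/eqP/red_eq0[y ->]|] := boolP (red K x == 0); last by exists 0.
  by exists y; rewrite eqxx implybT.
exists (\matrix_(i, j) xchoose (D (A i j))).
apply/matrixP=> i j; rewrite !mxE.
apply/eqP; have /implyP := xchooseP (D (A i j)); apply.
by move/matrixP/(_ i j): A0; rewrite !mxE => ->.
Qed.

Lemma unimodularP m k (A : 'M[K]_(m, k)) :
  reflect (exists B, A *m B = 1%:M) (unimodular A).
Proof.
apply: (iffP existsP) => [[B /eqP] | [B AB]]; first by exists B.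
by exists B; rewrite AB.
Qed.

(** A right inverse over the residue field lifts: [A *m L] reduces to the identity, so it is
    invertible and [L] can be corrected by its inverse. Unimodularity thus becomes a rank
    computation over F_p. *)
Lemma unimodular_red m k (A : 'M[K]_(m, k)) : unimodular A = row_free A^r.
Proof.
apply/unimodularP/row_freeP => [] [B AB].
  by exists B^r; rewrite -map_mxM AB map_mx1.
set L := map_mx (@rlift K) B.
have u : A *m L \in unitmx.
  by rewrite unitmx_red map_mxM rlift_mxK AB unitmx1.
by exists (L *m invmx (A *m L)); rewrite mulmxA mulmxV.
Qed.

Lemma unimodular_lin_indep m k (A : 'M[K]_(m, k)) : unimodular A -> lin_indep A.
Proof.
move=> /unimodularP[B AB]; apply/forallP=> u; apply/implyP=> /eqP uA.
by rewrite -[u]mulmx1 -AB mulmxA uA mul0mx.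
Qed.

Lemma unimodular_inj m k (A : 'M[K]_(m, k)) :
  unimodular A -> forall l, injective (fun u : 'M_(l, m) => u *m A).
Proof.
move=> /unimodularP[B AB] l u v /= /(congr1 (mulmx^~ B)).
by rewrite -!mulmxA AB !mulmx1.
Qed.

Lemma unimodular_factor m l k (A : 'M[K]_(m, l)) (B : 'M_(l, k)) :
  unimodular (A *m B) -> unimodular A.
Proof.
move=> /unimodularP[C]; rewrite -mulmxA => AC.
by apply/unimodularP; exists (B *m C).
Qed.

Lemma unimodular_row m k (A : 'M[K]_(m, k)) i : unimodular A -> (row i A)^r != 0.
Proof.
rewrite unimodular_red map_row => /row_freeP[B /(congr1 (row i))].
rewrite row_mul row1; case: eqP => // -> /rowP/(_ i).
by rewrite mul0mx !mxE !eqxx => /eqP; rewrite eq_sym oner_eq0.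
Qed.

Lemma base_of_rank (F : fieldType) m k n (A : 'M[F]_(m, n)) :
  \rank A = k -> exists2 B : 'M_(k, n), row_free B & (B :=: A)%MS.
Proof.
by move=> <-; exists (row_base A); [exact: row_base_free | exact: eq_row_base].
Qed.

Lemma left_inverse_cast k n (C D : 'M[K]_(k, n)) (B : 'M_(n, k)) :
  k = n -> C *m B = 1%:M -> B *m C = 1%:M.
Proof. by move=> e; subst n; apply: mulmx1C. Qed.

(* The blocks of an invertible matrix extending A, and of its inverse. *)
Lemma unimodular_complete k j n (A : 'M[K]_(k, n)) :
  (k + j)%N = n -> unimodular A ->
  exists (A' : 'M_(j, n)) (N : 'M_(n, k)) (N' : 'M_(n, j)),
   [/\ N *m A + N' *m A' = 1%:M, A *m N = 1%:M, A' *m N' = 1%:M,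
       A *m N' = 0 & A' *m N = 0].
Proof.
move=> kj uA; have rA : \rank A^r = k by move: uA; rewrite unimodular_red => /eqP.
have rC : \rank (A^r^C)%MS = j by rewrite mxrank_compl rA -kj addKn.
have [B fB eB] := base_of_rank rC.
pose A' := map_mx (@rlift K) B.
have uC : unimodular (col_mx A A').
  rewrite unimodular_red map_col_mx rlift_mxK -row_leq_rank -addsmxE.
  by rewrite (adds_eqmx (eqmx_refl _) eB) kj col_leq_rank addsmx_compl_full.
have [C AC] := unimodularP _ uC.
have := left_inverse_cast 0 kj AC.
rewrite -[C]hsubmxK mul_row_col => CA.
move: AC; rewrite -[C]hsubmxK mul_col_row (scalar_mx_block _ _ 1).
by move=> /eq_block_mx[a b c d]; exists A', (lsubmx C), (rsubmx C).
Qed.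

Lemma rowspanP k n (A : 'M[K]_(k, n)) x :
  reflect (exists u, x = u *m A) (x \in rowspan A).
Proof.
by apply: (iffP imsetP) => [[u _ ->] | [u ->]]; exists u.
Qed.

Lemma mem_rowspan k n (A : 'M[K]_(k, n)) u : u *m A \in rowspan A.
Proof. by apply/rowspanP; exists u. Qed.

Lemma row_rowspan k n (A : 'M[K]_(k, n)) i : row i A \in rowspan A.
Proof. by rewrite rowE mem_rowspan. Qed.

Lemma subspaceP k n (X : {set 'rV[K]_n}) :
  reflect (exists2 A : 'M_(k, n), unimodular A & X = rowspan A) (is_subspace k X).
Proof.
apply: (iffP existsP) => [[A /and3P[uA _ /eqP eX]] | [A uA eX]]; first by exists A.
by exists A; rewrite /represents uA unimodular_lin_indep ?eX /=.
Qed.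

Lemma rowspan_subspace k n (A : 'M[K]_(k, n)) :
  unimodular A -> is_subspace k (rowspan A).
Proof. by move=> uA; apply/subspaceP; exists A. Qed.

Definition lin_closed n (X : {set 'rV[K]_n}) :=
  forall (a : K) x y, x \in X -> y \in X -> a *: x + y \in X.

Lemma rowspan_closed k n (A : 'M[K]_(k, n)) : lin_closed (rowspan A).
Proof.
move=> a _ _ /rowspanP[u ->] /rowspanP[v ->].
by rewrite scalemxAl -mulmxDl mem_rowspan.
Qed.

Lemma subspace_closed k n (X : {set 'rV[K]_n}) : is_subspace k X -> lin_closed X.
Proof. by move=> /subspaceP[A _ ->]; apply: rowspan_closed. Qed.

Lemma subspace0 k n (X : {set 'rV[K]_n}) : is_subspace k X -> 0 \in X.
Proof.
by move=> /subspaceP[A _ ->]; apply/rowspanP; exists 0; rewrite mul0mx.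
Qed.

Lemma subspaceZ k n (X : {set 'rV[K]_n}) (a : K) x :
  is_subspace k X -> x \in X -> a *: x \in X.
Proof.
move=> sX xX; rewrite -[a *: x]addr0.
exact: subspace_closed sX _ _ _ xX (subspace0 sX).
Qed.

Lemma subspaceD k n (X : {set 'rV[K]_n}) x y :
  is_subspace k X -> x \in X -> y \in X -> x + y \in X.
Proof. by move=> sX xX yX; rewrite -[x]scale1r (subspace_closed sX). Qed.

Lemma subspaceB k n (X : {set 'rV[K]_n}) x y :
  is_subspace k X -> x \in X -> y \in X -> x - y \in X.
Proof. by move=> sX xX yX; rewrite addrC -scaleN1r (subspace_closed sX). Qed.

Lemma rowspan_subP k n (A : 'M[K]_(k, n)) (X : {set 'rV[K]_n}) :
  lin_closed X -> 0 \in X ->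
  reflect (forall i, row i A \in X) (rowspan A \subset X).
Proof.
move=> cX X0; apply: (iffP subsetP) => [sAX i | rX x /rowspanP[u ->]].
  by apply: sAX; apply: row_rowspan.
rewrite mulmx_sum_row; elim/big_ind: _ => //.
- by move=> x1 y xX yX; rewrite -[x1]scale1r cX.
- by move=> i _; rewrite -[_ *: _]addr0 cX.
Qed.

Lemma rowspan_sub_factor k l n (A : 'M[K]_(k, n)) (B : 'M_(l, n)) :
  rowspan A \subset rowspan B -> exists E, A = E *m B.
Proof.
move=> sAB; have D i : exists u, row i A == u *m B.
  have /rowspanP[u ->] := subsetP sAB _ (row_rowspan A i).
  by exists u.
exists (\matrix_i xchoose (D i)); apply/row_matrixP=> i.
by rewrite row_mul rowK; apply/eqP; apply: (xchooseP (D i)).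
Qed.

Lemma rowspan_mul k l n (E : 'M[K]_(k, l)) (B : 'M_(l, n)) :
  rowspan (E *m B) \subset rowspan B.
Proof. by apply/subsetP=> x /rowspanP[u ->]; rewrite mulmxA mem_rowspan. Qed.

Lemma rowspan_unit k n (E : 'M[K]_k) (B : 'M_(k, n)) :
  E \in unitmx -> rowspan (E *m B) = rowspan B.
Proof.
move=> uE; apply/eqP; rewrite eqEsubset rowspan_mul /=.
by rewrite -{1}[B](mulKmx uE) rowspan_mul.
Qed.

Lemma card_subspace k n (X : {set 'rV[K]_n}) :
  is_subspace k X -> #|X| = (#|K| ^ k)%N.
Proof.
move=> /subspaceP[A uA ->]; rewrite card_imset ?card_mx ?mul1n //.
exact: unimodular_inj uA _.
Qed.

Lemma subspace_eq k n (X Y : {set 'rV[K]_n}) :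
  is_subspace k X -> is_subspace k Y -> X \subset Y -> X = Y.
Proof.
move=> /card_subspace cX /card_subspace cY sXY.
by apply/eqP; rewrite eqEcard sXY cX cY leqnn.
Qed.

End LocalRing.

(** * Submodules and their reductions modulo the maximal ideal *)

Section Residue.

Variables (K : chainRing) (n : nat).
Implicit Types X Y Z A B P Q : {set 'rV[K]_n}.

(** The outer [<<_>>] picks the canonical matrix of the row space, so congruence modulo the maximal
    ideal is plain equality; the inner one gives all summands the same size. *)
Definition residue X : 'M['k K]_n := <<(\sum_(x in X) <<x^r>>)%MS>>%MS.

Lemma mem_residue X x : x \in X -> (x^r <= residue X)%MS.
Proof.
by move=> xX; rewrite genmxE; apply: (sumsmx_sup x) => //; rewrite genmxE.
Qed.

Lemma residue_subP X k (V : 'M_(k, n)) :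
  reflect (forall x, x \in X -> (x^r <= V)%MS) (residue X <= V)%MS.
Proof.
rewrite genmxE; apply: (iffP sumsmx_subP) => sXV x /sXV; first by rewrite genmxE.
by rewrite genmxE.
Qed.

Lemma residue_rowspan k (M : 'M[K]_(k, n)) : (residue (rowspan M) :=: M^r)%MS.
Proof.
apply/eqmxP/andP; split.
  by apply/residue_subP=> _ /rowspanP[u ->]; rewrite map_mxM submxMl.
by apply/row_subP=> i; rewrite -map_row mem_residue ?row_rowspan.
Qed.

Lemma residueS X Y : X \subset Y -> (residue X <= residue Y)%MS.
Proof. by move=> sXY; apply/residue_subP=> x /(subsetP sXY)/mem_residue. Qed.

Lemma rank_residue k X : is_subspace k X -> \rank (residue X) = k.
Proof.
move=> /subspaceP[M uM ->]; rewrite residue_rowspan.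
by apply/eqP; rewrite -[_ == k]/(row_free M^r) -unimodular_red.
Qed.

Lemma residue_eqP X Y : reflect (residue X = residue Y) (residue X == residue Y)%MS.
Proof.
by apply: (iffP genmxP) => eXY; [move: eXY; rewrite /residue !genmx_id | rewrite eXY].
Qed.

Lemma residue_leP k X Y : is_subspace k X -> is_subspace k Y ->
  reflect (residue X = residue Y) (residue X <= residue Y)%MS.
Proof.
move=> /rank_residue rX /rank_residue rY; apply: (iffP idP) => [s | -> //].
by apply/residue_eqP; rewrite -(geq_leqif (mxrank_leqif_eq s)) rX rY.
Qed.

Lemma residue_lift k X (w : 'rV_n) : is_subspace k X -> (w <= residue X)%MS ->
  exists2 x, x \in X & x^r = w.
Proof.
move=> /subspaceP[M _ ->]; rewrite residue_rowspan => /submxP[u ->].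
exists (map_mx (@rlift K) u *m M); first exact: mem_rowspan.
by rewrite map_mxM rlift_mxK.
Qed.

Lemma residue_subPn X k (V : 'M_(k, n)) :
  ~~ (residue X <= V)%MS -> exists2 x, x \in X & ~~ (x^r <= V)%MS.
Proof.
move=> nXV; case: (pickP [pred x in X | ~~ (x^r <= V)%MS]) => [x /andP[] | no].
  by exists x.
case/residue_subP: nXV => x xX.
by move/(_ x): no; rewrite /= xX => /negbFE.
Qed.

Lemma subspace_extend k X x : is_subspace k X -> ~~ (x^r <= residue X)%MS ->
  exists Y, [/\ is_subspace k.+1 Y, X \subset Y, x \in Y,
     (residue Y :=: residue X + x^r)%MS &
     forall y, y \in Y -> exists2 z, z \in X & exists a : K, y = z + a *: x].
Proof.
move=> /subspaceP[M uM ->]; rewrite residue_rowspan => nxM.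
have rMx : (residue (rowspan (col_mx M x)) :=: residue (rowspan M) + x^r)%MS.
  apply: eqmx_trans (residue_rowspan _) _; rewrite map_col_mx.
  apply: eqmx_trans (eqmx_sym (addsmxE _ _)) _.
  by apply: adds_eqmx => //; apply: eqmx_sym (residue_rowspan _).
exists (rowspan (col_mx M x)); split=> //.
- rewrite -addn1; apply: rowspan_subspace; rewrite unimodular_red.
  rewrite -row_leq_rank -residue_rowspan rMx addn1.
  rewrite -[in X in (X < _)%N](rank_residue (rowspan_subspace uM)) ltnNge.
  rewrite (geq_leqif (mxrank_leqif_sup (addsmxSl _ _))).
  by rewrite addsmx_sub submx_refl residue_rowspan.
- apply/subsetP=> _ /rowspanP[u ->]; apply/rowspanP; exists (row_mx u 0).
  by rewrite mul_row_col mul0mx addr0.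
- by apply/rowspanP; exists (row_mx 0 1); rewrite mul_row_col mul0mx add0r mul1mx.
- move=> _ /rowspanP[u ->]; rewrite -[u]hsubmxK mul_row_col.
  exists (lsubmx u *m M); first exact: mem_rowspan.
  by exists (rsubmx u 0 0); rewrite {1}[rsubmx u]mx11_scalar mul_scalar_mx.
Qed.

Lemma subspace_le k l X Y : is_subspace k X -> is_subspace l Y ->
  X \subset Y -> (k <= l)%N.
Proof.
by move=> /rank_residue <- /rank_residue <- /residueS; apply: mxrankS.
Qed.

Lemma extend_sub k l X x Y Z : is_subspace k X -> is_subspace l Z ->
  (forall y, y \in Y -> exists2 z, z \in X & exists a : K, y = z + a *: x) ->
  X \subset Z -> x \in Z -> Y \subset Z.
Proof.
move=> sX sZ dY /subsetP sXZ xZ; apply/subsetP=> y /dY[z /sXZ zZ [a ->]].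
by apply: (subspaceD sZ) => //; apply: (subspaceZ _ sZ).
Qed.

Lemma residue_exchange (V : 'M['k K]_n) (w y : 'rV_n) :
  ~~ (w <= V)%MS -> ~~ (y <= V + w)%MS -> ~~ (w <= V + y)%MS.
Proof.
move=> nwV; apply: contra => /sub_addsmxP[[u v] /= e].
have [v0 | nv0] := eqVneq (v 0 0) 0.
  case/negP: nwV; rewrite e [v]mx11_scalar v0 mul_scalar_mx scale0r addr0.
  exact: submxMl.
have -> : y = (v 0 0)^-1 *: (w - u *m V).
  rewrite e {2}[v]mx11_scalar mul_scalar_mx addrC addKr scalerA mulVf //.
  by rewrite scale1r.
rewrite scalemx_sub // addmx_sub //; first exact: addsmxSr.
by rewrite eqmx_opp (submx_trans (submxMl _ _)) ?addsmxSl.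
Qed.

Lemma rank_adds_row (F : fieldType) m l (V : 'M[F]_(m, l)) (w : 'rV_l) :
  (\rank (V + w)%MS <= (\rank V).+1)%N.
Proof.
apply: leq_trans (mxrank_adds_leqif _ _) _.
by rewrite -[leqRHS]addn1 leq_add2l rank_leq_row.
Qed.

(** [D] grows one vector at a time: by rank some [y] in [B] lies outside D + w over the residue
    field, and by exchange [w] then stays outside D + y. *)
Lemma interpolate_avoiding d k b D B (w : 'rV_n) :
  is_subspace d D -> is_subspace b B -> D \subset B -> (d <= k < b)%N ->
  ~~ (w <= residue D)%MS ->
  exists H, [/\ is_subspace k H, D \subset H, H \subset B & ~~ (w <= residue H)%MS].
Proof.
move=> sD sB; have [j] := ubnP (k - d); elim: j => // j IH in d D sD *.
rewrite ltnS => lj sDB /andP[dk kb] nw.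
have [ltdk | kd] := ltnP d k; last first.
  move: nw; have {}dk : d = k by apply/eqP; rewrite eqn_leq dk.
  by exists D; rewrite -dk.
have nB : ~~ (residue B <= residue D + w)%MS.
  apply/negP=> /mxrankS; rewrite (rank_residue sB) leqNgt.
  rewrite (leq_ltn_trans (rank_adds_row _ _)) // (rank_residue sD).
  exact: leq_ltn_trans ltdk kb.
have [y yB ny] := residue_subPn nB.
have nyD : ~~ (y^r <= residue D)%MS.
  by apply: contra ny => s; apply: submx_trans s (addsmxSl _ _).
have [Y [sY sDY yY rY dY]] := subspace_extend sD nyD.
have [||||H [sH YH HB nwH]] := IH _ _ sY.
- by rewrite (leq_trans _ lj) // ltn_sub2l.
- exact: extend_sub sD sB dY sDB yB.
- by rewrite ltdk.
- by rewrite rY residue_exchange.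
by exists H; split=> //; apply: subset_trans sDY YH.
Qed.

Lemma interpolate d k b D B :
  is_subspace d D -> is_subspace b B -> D \subset B -> (d <= k <= b)%N ->
  exists H, [/\ is_subspace k H, D \subset H & H \subset B].
Proof.
move=> sD sB sDB /andP[dk]; rewrite leq_eqVlt => /predU1P[-> | kb].
  by exists B.
have nB : ~~ (residue B <= residue D)%MS.
  apply/negP=> /mxrankS; rewrite (rank_residue sB) (rank_residue sD).
  by rewrite leqNgt (leq_ltn_trans dk).
have [y yB ny] := residue_subPn nB.
have dkb : (d <= k < b)%N by rewrite dk.
have [H [sH DH HB _]] := interpolate_avoiding sD sB sDB dkb ny.
by exists H.
Qed.

Lemma point_subspace (x : 'rV[K]_n) : x^r != 0 -> is_subspace 1 (rowspan x).
Proof.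
move=> x0; apply: rowspan_subspace.
by rewrite unimodular_red -row_leq_rank lt0n mxrank_eq0.
Qed.

Lemma mem_point (x : 'rV[K]_n) : x \in rowspan x.
Proof. by apply/rowspanP; exists 1%:M; rewrite mul1mx. Qed.

Lemma point_sub k X (x : 'rV[K]_n) : is_subspace k X -> x \in X -> rowspan x \subset X.
Proof.
move=> sX xX; apply/subsetP=> y /rowspanP[a ->].
by rewrite [a]mx11_scalar mul_scalar_mx (subspaceZ _ sX).
Qed.

Lemma zero_subspace : is_subspace 0 [set 0 : 'rV[K]_n].
Proof.
apply/subspaceP; exists 0; first by rewrite unimodular_red -row_leq_rank.
apply/setP=> x; rewrite inE; apply/eqP/rowspanP => [-> | [u ->]].
  by exists 0; rewrite mul0mx.
by rewrite mulmx0.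
Qed.

Lemma full_subspace : is_subspace n [set: 'rV[K]_n].
Proof.
apply/subspaceP; exists 1%:M.
  by apply/unimodularP; exists 1%:M; rewrite mulmx1.
by apply/setP=> x; rewrite inE; apply/esym/rowspanP; exists x; rewrite mulmx1.
Qed.

Lemma exists_sub k b B : is_subspace b B -> (k <= b)%N ->
  exists2 H, is_subspace k H & H \subset B.
Proof.
move=> sB kb; have s0B : [set 0] \subset B by rewrite sub1set (subspace0 sB).
by have [H [sH _ HB]] := interpolate zero_subspace sB s0B kb; exists H.
Qed.

Lemma exists_sup k b B : is_subspace b B -> (b <= k <= n)%N ->
  exists2 H, is_subspace k H & B \subset H.
Proof.
move=> sB kb; by have [H [sH BH _]] := interpolate sB full_subspace (subsetT _) kb; exists H.
Qed.

(** A basis of [Q] and [z] together form a unimodular, hence linearly independent, system. So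
    independence over the residue field excludes every nonzero multiple of [z], even by a zero
    divisor. *)
Lemma extension_disjoint j Q z (c : K) : is_subspace j Q ->
  ~~ (z^r <= residue Q)%MS -> c *: z \in Q -> c = 0.
Proof.
move=> sQ nz; have /subspaceP[M uM eQ] := sQ; rewrite {1}eQ => /rowspanP[u cz].
have /unimodular_lin_indep/forallP/(_ (row_mx (- u) c%:M))/implyP : unimodular (col_mx M z).
  rewrite unimodular_red map_col_mx -row_leq_rank -addsmxE addn1.
  have eM : (residue Q :=: M^r)%MS by rewrite eQ; apply: residue_rowspan.
  have rM : \rank M^r = j by rewrite -eM (rank_residue sQ).
  rewrite -[in X in (X < _)%N]rM ltnNge (geq_leqif (mxrank_leqif_sup (addsmxSl _ _))).
  by rewrite addsmx_sub submx_refl -eM.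
rewrite mul_row_col mulNmx mul_scalar_mx cz addNr eqxx => /(_ isT)/eqP.
rewrite -[0]row_mx0 => /eq_row_mx[_ /matrixP/(_ 0 0)].
by rewrite !mxE eqxx.
Qed.

Lemma hyperplane_decomp k Z A z : is_subspace k.+1 Z -> is_subspace k A ->
  A \subset Z -> z \in Z -> ~~ (z^r <= residue A)%MS ->
  forall y, y \in Z -> exists2 a, a \in A & exists c : K, y = a + c *: z.
Proof.
move=> sZ sA AZ zZ nz.
have [Y [sY AY zY _ dY]] := subspace_extend sA nz.
suff <- : Y = Z by [].
exact: subspace_eq sY sZ (extend_sub sA sZ dY AZ zZ).
Qed.

Lemma hyperplane_cap k j Z A Q : is_subspace k.+1 Z -> is_subspace k A ->
  is_subspace j Q -> A \subset Z -> A \subset Q -> ~~ (residue Z <= residue Q)%MS ->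
  Z :&: Q = A.
Proof.
move=> sZ sA sQ AZ AQ /residue_subPn[z zZ nz].
have nzA : ~~ (z^r <= residue A)%MS.
  by apply: contra nz => s; apply: submx_trans s (residueS AQ).
apply/eqP; rewrite eqEsubset subsetI AZ AQ !andbT.
apply/subsetP=> y /setIP[yZ yQ].
have [a aA [c yE]] := hyperplane_decomp sZ sA AZ zZ nzA yZ.
suff c0 : c = 0 by rewrite yE c0 scale0r addr0.
apply: (extension_disjoint sQ nz).
have -> : c *: z = y - a by rewrite yE addrC addKr.
by apply: (subspaceB sQ) => //; apply: (subsetP AQ).
Qed.

Lemma hyperplane_join k j Z A B Q : is_subspace k.+1 Z -> is_subspace k A ->
  is_subspace k B -> is_subspace j Q -> A \subset Z -> B \subset Z ->
  residue A != residue B -> A \subset Q -> B \subset Q -> Z \subset Q.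
Proof.
move=> sZ sA sB sQ AZ BZ nAB AQ BQ.
have /residue_subPn[b bB nb] : ~~ (residue B <= residue A)%MS.
  by apply: contra nAB => s; rewrite eq_sym; apply/eqP/(residue_leP sB sA).
apply: extend_sub sA sQ (hyperplane_decomp sZ sA AZ (subsetP BZ _ bB) nb) AQ _.
exact: (subsetP BQ).
Qed.

(* Write y modulo X as a power of the uniformizer times a vector z; decreasing
   the power until z is independent of X in the residue field. *)
Lemma subspace_absorb k X (y : 'rV[K]_n) : is_subspace k X -> (k < n)%N ->
  exists Q, [/\ is_subspace k.+1 Q, X \subset Q & y \in Q].
Proof.
move=> sX kn.
suff main i z : (i <= len K)%N -> exists Q,
    [/\ is_subspace k.+1 Q, X \subset Q & unif K ^+ i *: z \in Q].
  by have := main 0 y isT; rewrite scale1r.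
have [j] := ubnP (len K - i); elim: j => // j IH in i z *; rewrite ltnS => lj.
rewrite leq_eqVlt => /predU1P[-> | li].
  have [|Q sQ XQ] := @exists_sup k.+1 _ _ sX; first by rewrite leqnSn.
  by exists Q; split=> //; rewrite unif_nilp scale0r (subspace0 sQ).
have [rz | nz] := boolP (z^r <= residue X)%MS; last first.
  have [Q [sQ XQ zQ _ _]] := subspace_extend sX nz.
  by exists Q; split=> //; apply: subspaceZ sQ zQ.
have [x xX xz] := residue_lift sX rz.
have [|z' ez] := @red_mx0P _ _ _ (z - x); first by rewrite map_mxB xz subrr.
have [||Q [sQ XQ zQ]] := IH i.+1 z'; [by rewrite (leq_trans _ lj) // ltn_sub2l | done | ].
exists Q; split=> //; have -> : z = x + unif K *: z' by rewrite -ez addrC subrK.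
rewrite scalerDr scalerA -exprSr (subspaceD sQ) // (subspaceZ _ sQ) //.
exact: (subsetP XQ).
Qed.

(** [Y] is spanned by [P] and one vector [y], so a (k+2)-subspace over [X] containing [y] suffices.
    As [y] may be congruent to a vector of [X], adjoining it directly can fail, hence
    [subspace_absorb]. *)
Lemma common_sup k X Y P : is_subspace k.+1 X -> is_subspace k.+1 Y ->
  is_subspace k P -> P \subset X -> P \subset Y -> (k.+1 < n)%N ->
  exists Q, [/\ is_subspace k.+2 Q, X \subset Q & Y \subset Q].
Proof.
move=> sX sY sP PX PY kn.
have /residue_subPn[y yY ny] : ~~ (residue Y <= residue P)%MS.
  apply/negP=> /mxrankS.
  by rewrite (rank_residue sY) (rank_residue sP) ltnn.
have [Q [sQ XQ yQ]] := subspace_absorb y sX kn.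
exists Q; split=> //.
apply: extend_sub sP sQ (hyperplane_decomp sY sP PY yY ny) _ yQ.
exact: subset_trans PX XQ.
Qed.

Lemma dualP k (M : 'M[K]_(k, n)) y : (y \in dual (rowspan M)) = (y *m M^T == 0).
Proof.
rewrite inE; apply/forall_inP/eqP => [yM | yM x /rowspanP[u ->]].
  apply/rowP=> i; have /eqP/matrixP/(_ 0 0) := yM _ (row_rowspan M i).
  by rewrite !mxE => e; rewrite -[RHS]e; apply: eq_bigr => j _; rewrite !mxE.
by rewrite trmx_mul mulmxA yM mul0mx.
Qed.

(** Complete [M] to an invertible matrix. The columns of [N'], taken from the inverse, lie in the
    dual because [M *m N' = 0], and the decomposition of the identity shows that they span it. *)
Lemma dual_subspace k X : is_subspace k X -> is_subspace (n - k) (dual X).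
Proof.
move=> sX; have kn : (k <= n)%N := subspace_le sX full_subspace (subsetT _).
have /subspaceP[M uM ->] := sX.
have [M' [N [N' [e1 e2 e3 e4 e5]]]] := unimodular_complete (subnKC kn) uM.
apply/subspaceP; exists N'^T.
  by apply/unimodularP; exists M'^T; rewrite -trmx_mul e3 trmx1.
apply/setP=> y; rewrite dualP; apply/eqP/rowspanP => [yM | [u ->]].
  exists (y *m M'^T); rewrite -mulmxA -trmx_mul.
  rewrite -{1}[y]mulmx1 -trmx1 -e1 linearD /= mulmxDr trmx_mul mulmxA yM.
  by rewrite mul0mx add0r.
by rewrite -mulmxA -trmx_mul e4 trmx0 mulmx0.
Qed.

Lemma subspace_dim k X : is_subspace k X -> (k <= n)%N.
Proof. by move=> sX; apply: subspace_le sX full_subspace (subsetT _). Qed.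

Lemma dualK k X : is_subspace k X -> dual (dual X) = X.
Proof.
move=> sX; have kn := subspace_dim sX; apply/esym.
have := dual_subspace (dual_subspace sX); rewrite subKn // => sXX.
apply: subspace_eq sX sXX _; apply/subsetP=> x xX; rewrite inE.
apply/forall_inP=> y; rewrite inE => /forall_inP/(_ x xX)/eqP/(congr1 trmx).
by rewrite trmx_mul trmxK trmx0 => ->.
Qed.

Lemma dualS X Y : X \subset Y -> dual Y \subset dual X.
Proof.
move=> /subsetP sXY; apply/subsetP=> y; rewrite !inE => /forall_inP yY.
by apply/forall_inP=> x /sXY/yY.
Qed.

(** Dual to [common_sup]. Intersecting [X] and [Y] would not do, as the intersection need not be a
    subspace. *)
Lemma common_sub k X Y Q : is_subspace k.+1 X -> is_subspace k.+1 Y ->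
  is_subspace k.+2 Q -> X \subset Q -> Y \subset Q ->
  exists P, [/\ is_subspace k P, P \subset X & P \subset Y].
Proof.
move=> sX sY sQ XQ YQ; have kn := subspace_dim sQ.
have e1 : (n - k.+1 = (n - k.+2).+1)%N by rewrite subnSK.
have e2 : (n - (n - k.+2).+2 = k)%N by lia.
move: (dual_subspace sX) (dual_subspace sY) (dual_subspace sQ).
rewrite e1 => sX' sY' sQ'.
have [|P [sP XP YP]] := common_sup sX' sY' sQ' (dualS XQ) (dualS YQ); first by lia.
exists (dual P); split; first by rewrite -[k]e2; apply: dual_subspace.
  by rewrite -(dualK sX) dualS.
by rewrite -(dualK sY) dualS.
Qed.

End Residue.

(** * Graph adjacency in terms of common subspaces *)

Section Adjacency.

Variables (K : chainRing) (n : nat).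
Implicit Types X Y Z A B P Q V : {set 'rV[K]_n}.

Lemma leq_dimP j V : lin_closed V -> 0 \in V ->
  reflect (exists2 P, is_subspace j P & P \subset V) (j <= Defs.dim V)%N.
Proof.
move=> cV V0; apply: (iffP idP) => [jV | [P /subspaceP[M uM ->] PV]].
  (* The empty set is unimodular, so the maximum defining the dimension is attained. *)
  have : (0 < #|[pred S : {set 'rV[K]_n} | (S \subset V) && unimodular_set S]|)%N.
    apply/card_gt0P; exists set0; rewrite inE sub0set /unimodular_set.
    by rewrite unimodular_red -row_leq_rank; apply: (@leq_trans 0); rewrite ?cards0.
  case/(eq_bigmax_cond (fun S : {set 'rV[K]_n} => #|S|)) => S; rewrite inE => /andP[SV uS] dV.
  have sM : rowspan (\matrix_(i < #|S|) (enum_val i : 'rV[K]_n)) \subset V.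
    apply/(rowspan_subP _ cV V0) => i; rewrite rowK.
    by apply: (subsetP SV); apply: enum_valP.
  have [|P sP PM] := exists_sub (rowspan_subspace uS) (k := j).
    by rewrite -dV.
  by exists P => //; apply: subset_trans PM sM.
(* The rows must be distinct, because [dim] counts a set of vectors, which would merge equal
   ones. *)
have rinj : injective (fun i => row i M).
  move=> i1 i2 /=; rewrite !rowE => /(unimodular_inj uM)/matrixP/(_ 0 i2).
  by rewrite !mxE !eqxx /=; case: eqVneq => // _ /esym/eqP; rewrite ?oner_eq0.
pose S := [set row i M | i in 'I_j].
have cS : #|S| = j by rewrite card_imset // card_ord.
rewrite -[j]cS; apply: (leq_bigmax_cond (F := fun S : {set 'rV[K]_n} => #|S|)).
apply/andP; split.
  apply/subsetP=> _ /imsetP[i _ ->]; apply: (subsetP PV); exact: row_rowspan.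
have MS : (M^r <= (\matrix_(i < #|S|) (enum_val i : 'rV[K]_n))^r)%MS.
  apply/row_subP=> i; have iS : row i M \in S by apply: imset_f.
  rewrite -map_row -(enum_rankK_in iS iS); set e := enum_rank_in _ _.
  have -> : enum_val e = row e (\matrix_(i < #|S|) (enum_val i : 'rV[K]_n)).
    by rewrite rowK.
  by rewrite map_row row_sub.
rewrite /unimodular_set unimodular_red -row_leq_rank (leq_trans _ (mxrankS MS)) //.
by rewrite cS; move: uM; rewrite unimodular_red -row_leq_rank.
Qed.

(** A (k+1)-subspace inside [X :&: Y] would equal both, so distinct vertices sharing a k-subspace
    have an intersection of dimension exactly [k]. *)
Lemma adjP k X Y : is_subspace k.+1 X -> is_subspace k.+1 Y ->
  reflect (X != Y /\ exists P, [/\ is_subspace k P, P \subset X & P \subset Y])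
          (Defs.dim (X :&: Y) == k).
Proof.
move=> sX sY.
have cI : lin_closed (X :&: Y).
  move=> a x y /setIP[xX xY] /setIP[yX yY]; rewrite inE.
  by rewrite (subspace_closed sX) ?(subspace_closed sY).
have I0 : 0 \in X :&: Y by rewrite inE (subspace0 sX) (subspace0 sY).
apply: (iffP eqP) => [dk | [nXY [P [sP PX PY]]]].
  split.
    apply/eqP=> eXY; have /(leq_dimP _ cI I0) :
        exists2 P, is_subspace k.+1 P & P \subset X :&: Y.
      by exists X; rewrite // -eXY setIid.
    by rewrite dk ltnn.
  have /(leq_dimP _ cI I0)[P sP] : (k <= Defs.dim (X :&: Y))%N by rewrite dk.
  by rewrite subsetI => /andP[PX PY]; exists P.
apply/eqP; rewrite eqn_leq; apply/andP; split; last first.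
  by apply/(leq_dimP _ cI I0); exists P; rewrite // subsetI PX.
rewrite leqNgt; apply: contra nXY => /(leq_dimP _ cI I0)[Q sQ].
rewrite subsetI => /andP[QX QY].
by rewrite -(subspace_eq sQ sX QX) -(subspace_eq sQ sY QY).
Qed.

End Adjacency.

(** * Regular representation of a finite field *)

Section RegularMatrices.

Import VectorInternalTheory.

Lemma extension_matrices (F : fieldType) (L : fieldExtType F) m :
  (m <= \dim {: L})%N ->
  exists T : 'I_m -> 'M[F]_(\dim {: L}),
    forall c : 'rV[F]_m, c != 0 -> \sum_i c 0 i *: T i \in unitmx.
Proof.
rewrite dimvf => mL.
pose r : {linear 'rV_(vector.dim L) -> L} := @r2v F L.
have rK : cancel r v2r by exact: r2vK.
have vK : cancel v2r r by exact: v2rK.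
pose M (x : L) : 'M[F]_(vector.dim L) := \matrix_i v2r (x * r (delta_mx 0 i)).
have mulM (u : 'rV_(vector.dim L)) x : u *m M x = v2r (x * r u).
  rewrite mulmx_sum_row {2}[u]row_sum_delta !linear_sum mulr_sumr linear_sum /=.
  by apply: eq_bigr => i _; rewrite rowK !linearZ /= -scalerAr linearZ.
have MM x y : M x *m M y = M (y * x).
  by apply/row_matrixP=> i; rewrite row_mul mulM !rowK vK mulrA.
have M1 : M 1 = 1%:M.
  by apply/row_matrixP=> i; rewrite rowK mul1r rK row1.
have unitM x : x != 0 -> M x \in unitmx.
  by move=> x0; case: (@mulmx1_unit _ _ (M x) (M x^-1)); rewrite // MM mulVf.
exists (fun i => M (r (delta_mx 0 (widen_ord mL i)))) => c c0.
have -> : \sum_i c 0 i *: M (r (delta_mx 0 (widen_ord mL i))) =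
          M (r (\sum_i c 0 i *: delta_mx 0 (widen_ord mL i))).
  apply/row_matrixP=> j; rewrite linear_sum rowK /= !linear_sum mulr_suml linear_sum /=.
  by apply: eq_bigr => i _; rewrite !linearZ /= rowK -scalerAl linearZ.
apply: unitM; apply: contra c0 => /eqP/(congr1 v2r); rewrite rK linear0 => e.
apply/eqP/rowP=> j; move/rowP/(_ (widen_ord mL j)): e.
rewrite summxE (bigD1 j) //= big1 => [|i ij]; rewrite !mxE eqxx /=.
  by rewrite eqxx mulr1 addr0.
by rewrite -val_eqE /= eq_sym val_eqE (negPf ij) mulr0.
Qed.

(* Multiplication by the first m elements of a basis of the field of order p^k:
   their nonzero combinations are multiplications by nonzero field elements. *)
Lemma regular_matrices p k m : prime p -> (m <= k)%N ->
  exists T : 'I_m -> 'M['F_p]_k,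
    forall c : 'rV['F_p]_m, c != 0 -> \sum_i c 0 i *: T i \in unitmx.
Proof.
move=> pr_p; case: k => [|k] mk.
  (* No field has order p^0; here m = 0 and there is no nonzero [c]. *)
  exists (fun=> 0) => c; case/eqP; apply/rowP=> -[i lti].
  by have := leq_trans lti mk.
have [L pL cL] := pPrimePowerField pr_p (ltn0Sn k).
have dL : \dim {: pPrimeCharType pL} = k.+1.
  by rewrite pprimeChar_dimf cL pfactorK.
by rewrite -dL in mk *; apply: extension_matrices.
Qed.

End RegularMatrices.

(** * Stars, tops and large cliques *)

Section Counting.

Variable K : chainRing.

(** Order of the maximal ideal: p^(s-1) for the integers modulo p^s. *)
Definition card_rad := #|[set x : K | red K x == 0]|.

Lemma card_chain : #|K| = (card_rad * chain_char K)%N.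
Proof.
have Fp : #|'k K| = chain_char K by rewrite card_Fp ?chain_char_prime.
rewrite -Fp -cardsT -[#|'k K|]cardsT -cardsX.
pose f (u : K * 'k K) := u.1 + rlift u.2.
pose A := setX [set x : K | red K x == 0] [set: 'k K].
have finj : {in A &, injective f}.
  move=> [x a] [y b]; rewrite !in_setX !inE !andbT /= => /eqP x0 /eqP y0 e.
  have := congr1 (red K) e; rewrite /f !rmorphD /= !rliftK x0 y0 !add0r => ab.
  by move: e; rewrite /f /= ab => /addIr ->.
rewrite -(card_in_imset finj); congr #|pred_of_set _|; apply/setP=> x.
rewrite inE; apply/esym/imsetP; exists (x - rlift (red K x), red K x).
  by rewrite in_setX !inE /= rmorphB /= rliftK subrr eqxx.
by rewrite /f /= subrK.
Qed.

Lemma card_rad_gt0 : (0 < card_rad)%N.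
Proof. by apply/card_gt0P; exists 0; rewrite inE rmorph0. Qed.

Lemma card_units : #|[set x : K | x \is a GRing.unit]| = (card_rad * (chain_char K).-1)%N.
Proof.
have -> : [set x : K | x \is a GRing.unit] = ~: [set x | red K x == 0].
  by apply/setP=> x; rewrite !inE unitr_red.
have e : (card_rad * chain_char K = card_rad + card_rad * (chain_char K).-1)%N.
  by rewrite -mulnS prednK ?prime_gt0 ?chain_char_prime.
by have := cardsC [set x : K | red K x == 0]; rewrite card_chain e => /addnI.
Qed.

Lemma card_rad_row k : #|[set r : 'rV[K]_k | r^r == 0]| = (card_rad ^ k)%N.
Proof.
pose f (r : 'rV[K]_k) := [ffun i => r 0 i].
have finj : injective f.
  by move=> r t /ffunP e; apply/rowP=> i; have := e i; rewrite !ffunE.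
have -> : (card_rad ^ k = card_rad ^ #|'I_k|)%N by rewrite card_ord.
rewrite -(card_imset _ finj) -card_ffun_on.
apply: eq_card => g; apply/imsetP/ffun_onP => [[r] | gP].
  rewrite inE => /eqP/rowP r0 -> i; rewrite ffunE inE.
  by have := r0 i; rewrite !mxE => ->.
exists (\row_i g i); last by apply/ffunP=> i; rewrite ffunE mxE.
rewrite inE; apply/eqP/rowP=> i; rewrite !mxE.
by have := gP i; rewrite inE => /eqP.
Qed.

Lemma card_unimodular_row k :
  #|[set r : 'rV[K]_k | r^r != 0]| = (card_rad ^ k * ((chain_char K) ^ k).-1)%N.
Proof.
have -> : [set r : 'rV[K]_k | r^r != 0] = ~: [set r | r^r == 0].
  by apply/setP=> x; rewrite !inE.
have e : (card_rad ^ k * chain_char K ^ k =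
          card_rad ^ k + card_rad ^ k * (chain_char K ^ k).-1)%N.
  by rewrite -mulnS prednK // expn_gt0 prime_gt0 ?chain_char_prime.
have := cardsC [set r : 'rV[K]_k | r^r == 0].
by rewrite card_mx mul1n card_rad_row card_chain expnMn e => /addnI.
Qed.

Variable n : nat.
Implicit Types X Y Z A B P Q V : {set 'rV[K]_n}.

Definition star k P : {set {set 'rV[K]_n}} := [set X | is_subspace k X & P \subset X].
Definition top k Q : {set {set 'rV[K]_n}} := [set X | is_subspace k X & X \subset Q].

(** Modulo [P] a member of the star is a point of a free module of rank d = n - k. Rows of length d
    with nonzero residue yield all members, each as often as there are units. The factor p - 1
    avoids a division. *)
Lemma card_star k P : is_subspace k P -> (k < n)%N ->
  (#|star k.+1 P| * (chain_char K).-1 =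
   card_rad ^ (n - k.+1) * (chain_char K ^ (n - k)).-1)%N.
Proof.
move=> sP kn; have [M uM eP] := elimT (subspaceP _ _) sP.
have [M' [N [N' [e1 e2 e3 e4 e5]]]] := unimodular_complete (subnKC (ltnW kn)) uM.
set d := (n - k)%N in M' N' e1 e3 e4 e5 *.
apply/eqP; rewrite -(eqn_pmul2l card_rad_gt0) mulnCA -card_units mulnA -expnS.
rewrite subnSK // -/d -card_unimodular_row.
pose D := [set r : 'rV[K]_d | r^r != 0].
pose f (r : 'rV[K]_d) := rowspan (col_mx M (r *m M')).
have rinv r : r \in D -> exists t, r *m t = 1%:M.
  rewrite inE => r0; apply/unimodularP.
  by rewrite unimodular_red -row_leq_rank lt0n mxrank_eq0.
have uf r : r \in D -> unimodular (col_mx M (r *m M')).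
  move=> /rinv[t rt]; apply/unimodularP; exists (row_mx N (N' *m t)).
  rewrite mul_col_row !mulmxA e2 e4 -[r *m M' *m N]mulmxA e5 -[r *m M' *m N']mulmxA.
  by rewrite e3 mulmx1 mulmx0 mul0mx rt -scalar_mx_block.
have fE r x : x \in f r <-> exists u (a : K), x = u *m M + a *: (r *m M').
  split=> [/rowspanP[u ->] | [u [a ->]]].
    rewrite -[u]hsubmxK mul_row_col; exists (lsubmx u), (rsubmx u 0 0).
    by rewrite {1}[rsubmx u]mx11_scalar mul_scalar_mx.
  by apply/rowspanP; exists (row_mx u a%:M); rewrite mul_row_col mul_scalar_mx.
have fstar r : r \in D -> f r \in star k.+1 P.
  move=> rD; rewrite inE -addn1 rowspan_subspace ?uf //=.
  rewrite eP; apply/subsetP=> _ /rowspanP[u ->]; apply/fE; exists u, 0.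
  by rewrite scale0r addr0.
have fsub r k' X : is_subspace k' X -> P \subset X -> r *m M' \in X -> f r \subset X.
  move=> sX PX rX; apply/subsetP=> _ /fE[u [a ->]].
  apply: (subspaceD sX); last exact: (subspaceZ _ sX).
  by apply: (subsetP PX); rewrite eP mem_rowspan.
have rf r : r *m M' \in f r by apply/fE; exists 0, 1; rewrite mul0mx add0r scale1r.
have Pf r : P \subset f r.
  by rewrite eP; apply/subsetP=> _ /rowspanP[u ->]; apply/fE; exists u, 0;
    rewrite scale0r addr0.
(* The fibres of [f] are the orbits of the unit group, which acts freely on [D]. *)
rewrite -[#|D|]sum1_card (partition_big f (mem (star k.+1 P))) /=; last exact: fstar.
apply/eqP; rewrite -[LHS]sum_nat_const; apply: eq_bigr => X.
rewrite inE => /andP[sX PX].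
have [r rD eX] : exists2 r, r \in D & f r = X.
  have /residue_subPn[x xX nx] : ~~ (residue X <= residue P)%MS.
    by apply/negP=> /mxrankS; rewrite (rank_residue sX) (rank_residue sP) ltnn.
  have xE : x = x *m N *m M + x *m N' *m M'.
    by rewrite -!mulmxA -mulmxDr e1 mulmx1.
  have rD : x *m N' \in D.
    rewrite inE; apply: contra nx => /eqP; rewrite map_mxM => r0.
    by rewrite eP residue_rowspan xE map_mxD !map_mxM r0 mul0mx addr0 submxMl.
  exists (x *m N') => //.
  have := fstar _ rD; rewrite inE => /andP[sf _]; apply: (subspace_eq sf sX).
  apply: (fsub _ _ _ sX PX).
  have -> : x *m N' *m M' = x - x *m N *m M by rewrite {2}xE addrC addKr.
  by apply: (subspaceB sX) => //; apply: (subsetP PX); rewrite eP mem_rowspan.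
have [t rt] := rinv r rD.
rewrite sum1dep_card -[LHS](card_imset _ (f := fun a : K => a *: r)); last first.
  move=> a b /= /(congr1 (mulmx^~ t)).
  by rewrite -!scalemxAl rt => /matrixP/(_ 0 0); rewrite !mxE eqxx !mulr1.
apply: eq_card => r'; rewrite !inE -eX.
apply/imsetP/andP => [[a] | [r'0 /eqP efr]].
  rewrite inE => ua -> {r'}; have aD : a *: r \in D.
    rewrite inE map_mxZ scaler_eq0 negb_or -unitr_red ua /=.
    by move: rD; rewrite inE.
  split; first by move: aD; rewrite inE.
  have := fstar _ aD; have := fstar _ rD; rewrite !inE => /andP[sr _] /andP[sa _].
  apply/eqP/(subspace_eq sa sr)/(fsub _ _ _ sr (Pf r)).
  by rewrite -scalemxAl (subspaceZ _ sr).
have := rf r'; rewrite efr => /fE[u [a /(congr1 (mulmx^~ N'))]].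
rewrite mulmxDl -!mulmxA e4 e3 mulmx0 add0r mulmx1 -scalemxAl -mulmxA e3 mulmx1 => er.
exists a => //; rewrite inE unitr_red; apply: contra r'0 => /eqP a0.
by rewrite er map_mxZ a0 scale0r.
Qed.

End Counting.

Section Cliques.

Variables (K : chainRing) (n : nat).
Implicit Types X Y Z A B P Q V W : {set 'rV[K]_n}.
Implicit Type C : {set {set 'rV[K]_n}}.

(** Duality maps the top of [Q] bijectively onto the star of [dual Q]. *)
Lemma card_top k Q : is_subspace k.+2 Q ->
  (#|top k.+1 Q| * (chain_char K).-1 =
   card_rad K ^ k.+1 * (chain_char K ^ k.+2).-1)%N.
Proof.
move=> sQ; have kn := subspace_dim sQ.
have e1 : (n - (n - k.+2).+1 = k.+1)%N by lia.
have e2 : (n - (n - k.+2) = k.+2)%N by lia.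
have := card_star (dual_subspace sQ); rewrite e1 e2 => <-; last by lia.
congr (_ * _)%N.
have dinj : {in top k.+1 Q &, injective (@dual K n)}.
  move=> X Y; rewrite !inE => /andP[sX _] /andP[sY _] e.
  by rewrite -(dualK sX) e (dualK sY).
rewrite -(card_in_imset dinj); apply: eq_card => X.
have e3 : ((n - k.+2).+1 = n - k.+1)%N by lia.
rewrite !inE e3; apply/imsetP/andP => [[Y] | [sX QX]].
  by rewrite inE => /andP[sY YQ] ->; rewrite dual_subspace ?dualS.
exists (dual X); last by rewrite (dualK sX).
rewrite inE -(dualK sQ) dualS // andbT.
have -> : k.+1 = (n - (n - k.+1))%N by lia.
exact: dual_subspace.
Qed.

(** Here n - k >= 3, and (p^3 - 1)/(p - 1) already exceeds p + 1. The left side is the bound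
    obtained in [pencil_clique]. *)
Lemma card_star_gt k P : is_subspace k P -> (k.+2 < n)%N ->
  ((chain_char K).+1 * card_rad K ^ (n - k.+1) < #|star k.+1 P|)%N.
Proof.
move=> sP kn; have p2 := prime_gt1 (chain_char_prime K).
have r0 := card_rad_gt0 K.
have := card_star sP (ltnW (ltnW kn)).
have -> : (n - k = (n - k.+3).+3)%N by lia.
set p := chain_char K in p2 *; set R := (_ ^ (n - k.+1))%N => e.
have R0 : (0 < R)%N by rewrite expn_gt0 r0.
have p10 : (0 < p.-1)%N by rewrite -subn1 subn_gt0.
rewrite -(ltn_pmul2r p10) e mulnAC mulnC ltn_pmul2l //.
have le3 : (p ^ 3 <= p ^ (n - k.+3).+3)%N by rewrite leq_exp2l.
apply: leq_trans (_ : (p ^ 3).-1 <= _)%N; last by rewrite -!subn1 leq_sub2r.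
have -> : (p ^ 3 = p * (p * p))%N by rewrite !expnS muln1.
by move: p2; generalize p; clear=> q q2; nia.
Qed.

Definition clique k C := forall X Y, X \in C -> Y \in C -> X != Y ->
  exists P, [/\ is_subspace k P, P \subset X & P \subset Y].

(** A subspace congruent to the span of [M0] is the graph of a map with zero residue: the [M0]-part
    [M *m N] of its basis is invertible and can be normalized to 1. *)
Lemma residue_chart k j (M0 : 'M[K]_(k, n)) (M0' : 'M_(j, n)) N N' X :
  N *m M0 + N' *m M0' = 1%:M -> M0 *m N' = 0 ->
  is_subspace k X -> residue X = residue (rowspan M0) ->
  exists2 G : 'M_(k, j), G^r = 0 & X = rowspan (M0 + G *m M0').
Proof.
move=> e1 e4 /subspaceP[M uM ->] eX.
have ME : M = M *m N *m M0 + M *m N' *m M0'.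
  by rewrite -!mulmxA -mulmxDr e1 mulmx1.
have /submxP[E eE] : (M^r <= M0^r)%MS.
  by rewrite -(residue_rowspan M) eX residue_rowspan.
have MN'0 : (M *m N')^r = 0 by rewrite map_mxM eE -mulmxA -map_mxM e4 map_mx0 mulmx0.
have uMN : M *m N \in unitmx.
  have uu : unimodular (M *m N).
    apply: (@unimodular_factor _ _ _ _ _ M0).
    rewrite unimodular_red; move: uM; rewrite unimodular_red {1}ME.
    by rewrite map_mxD [X in _ + X]map_mxM MN'0 mul0mx addr0.
  by have /unimodularP[B /mulmx1_unit[]] := uu.
exists (invmx (M *m N) *m (M *m N')); first by rewrite map_mxM MN'0 mulmx0.
by rewrite -(rowspan_unit (M0 + _) uMN) mulmxDr [X in _ + X]mulmxA mulKVmx // -ME.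
Qed.

(* X |-> sum_i row_i(G) T_i, where G is the coordinate matrix of X in the chart at X0,
   is injective on C: differences of coordinate matrices have the form c r. *)
Lemma card_residue_clique k C X0 : is_subspace k.+1 X0 -> (k.+1 <= n - k.+1)%N ->
  (forall X, X \in C -> is_subspace k.+1 X /\ residue X = residue X0) ->
  clique k C -> (#|C| <= card_rad K ^ (n - k.+1))%N.
Proof.
move=> sX0 kn CX cC; have /subspaceP[M0 uM0 eX0] := sX0.
have [M0' [N [N' [e1 e2 e3 e4 e5]]]] :=
  unimodular_complete (subnKC (subspace_dim sX0)) uM0.
set d := (n - k.+1)%N in kn M0' N' e1 e3 e4 e5 *.
(* One matrix for each of the k+1 rows, possible because k+1 <= d. *)
have [T0 uT0] := regular_matrices (chain_char_prime K) kn.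
pose T i := map_mx (@rlift K) (T0 i).
have uT (c : 'rV[K]_k.+1) : c^r != 0 -> \sum_i c 0 i *: T i \in unitmx.
  move=> c0; rewrite unitmx_red.
  suff -> : (\sum_i c 0 i *: T i)^r = \sum_i c^r 0 i *: T0 i by apply: uT0.
  by rewrite raddf_sum; apply: eq_bigr => i _; rewrite /= map_mxZ rlift_mxK mxE.
have chart X : exists G : 'M_(k.+1, d),
    (X \in C) ==> (G^r == 0) && (X == rowspan (M0 + G *m M0')).
  have [XC | _] := boolP (X \in C); last by exists 0.
  have [sX rX] := CX X XC.
  have [G G0 eX] := residue_chart e1 e4 sX (etrans rX (congr1 (@residue K n) eX0)).
  by exists G; rewrite G0 eqxx -eX eqxx.
pose G X := xchoose (chart X).
have GP X : X \in C -> (G X)^r = 0 /\ X = rowspan (M0 + G X *m M0').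
  by move=> XC; have /implyP/(_ XC)/andP[/eqP ? /eqP] := xchooseP (chart X).
pose f X := \sum_i row i (G X) *m T i.
have f_inj : {in C &, injective f}.
  move=> X Y XC YC eXY; apply/eqP; apply: contraT => nXY.
  have [P [/subspaceP[U uU ->] PX PY]] := cC X Y XC YC nXY.
  have [gX EX] := GP X XC; have [gY EY] := GP Y YC.
  rewrite EX in PX; rewrite EY in PY.
  have [E eU] := rowspan_sub_factor PX; have [E' eU'] := rowspan_sub_factor PY.
  (* A common k-subspace has the same coordinates [E] in both charts, so [E] annihilates the
     difference of the coordinate matrices. *)
  have eE : E = E'.
    move: (congr1 (mulmx^~ N) eU) (congr1 (mulmx^~ N) eU') => /= -> .
    by rewrite -!mulmxA !mulmxDl -!mulmxA e2 e5 !mulmx0 !addr0 !mulmx1.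
  have eG : E *m G X = E *m G Y.
    move: (congr1 (mulmx^~ N') eU) (congr1 (mulmx^~ N') eU') => /= -> .
    by rewrite -eE -!mulmxA !mulmxDl -!mulmxA e4 e3 !add0r !mulmx1.
  have uE : unimodular E.
    by apply: (@unimodular_factor _ _ _ _ _ (M0 + G X *m M0')); rewrite -eU.
  (* The kernel of the k by k+1 matrix [E] is spanned by one column [c], so [E *m D = 0] forces D =
     c r. *)
  have [w [L [c [a1 a2 a3 a4 a5]]]] := unimodular_complete (addn1 k) uE.
  pose D := G X - G Y; pose r := w *m D.
  have ED : E *m D = 0 by rewrite mulmxBr eG subrr.
  have eD : D = c *m r by rewrite -[D]mul1mx -a1 mulmxDl -!mulmxA ED mulmx0 add0r.
  (* The equality f X = f Y reads r (sum of c_i T_i) = 0, and the sum is invertible because [c] has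
     nonzero residue. *)
  have rT : r *m (\sum_i c^T 0 i *: T i) = 0.
    rewrite -[RHS](subrr (f Y)) -{1}eXY /f -sumrB mulmx_sumr; apply: eq_bigr => i _.
    rewrite -mulmxBl -linearB /= -/D eD row_mul.
    by rewrite [row i c]mx11_scalar mul_scalar_mx !mxE -scalemxAr -scalemxAl.
  have c0 : (c^T)^r != 0.
    apply/eqP=> /(congr1 trmx); rewrite -map_trmx trmxK trmx0 => c0.
    move: (congr1 (map_mx (red K)) a3); rewrite map_mxM c0 mulmx0 map_mx1.
    by move/matrixP/(_ 0 0); rewrite !mxE eqxx => /esym/eqP; rewrite oner_eq0.
  have r0 : r = 0 by rewrite -[r](mulmxK (uT _ c0)) rT mul0mx.
  have gXY : G X = G Y by apply/eqP; rewrite -subr_eq0 -/D eD r0 mulmx0.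
  by case/eqP: nXY; rewrite EX EY gXY.
rewrite -(card_in_imset f_inj) -card_rad_row; apply: subset_leq_card.
apply/subsetP=> _ /imsetP[X XC ->]; rewrite inE; apply/eqP.
rewrite raddf_sum big1 // => i _; rewrite /= map_mxM map_row.
by have [-> _] := GP X XC; rewrite row0 mul0mx.
Qed.

End Cliques.

Section LargeCliques.

Variables (K : chainRing) (n : nat).
Implicit Types X Y Z A B P Q V W T : {set 'rV[K]_n}.
Implicit Type C : {set {set 'rV[K]_n}}.

Lemma residue_cap k U V T j (w : 'M_(j, n)) : is_subspace k.+1 U ->
  is_subspace k.+1 V -> is_subspace k T -> T \subset U -> T \subset V ->
  residue U != residue V -> (w <= residue U)%MS -> (w <= residue V)%MS ->
  (w <= residue T)%MS.
Proof.
move=> sU sV sT TU TV nUV wU wV.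
have sTI : (residue T <= residue U :&: residue V)%MS by rewrite sub_capmx !residueS.
suff s : (residue U :&: residue V <= residue T)%MS.
  by apply: submx_trans s; rewrite sub_capmx wU.
rewrite -(geq_leqif (mxrank_leqif_sup sTI)) (rank_residue sT) -ltnS.
rewrite -[X in (_ < X)%N](rank_residue sU) ltnNge.
rewrite (geq_leqif (mxrank_leqif_sup (capmxSl _ _))) sub_capmx submx_refl /=.
by apply: contra nUV => s; apply/eqP/(residue_leP sU sV).
Qed.

Lemma residue_join k Z A B (V : 'M_n) : is_subspace k.+1 Z -> is_subspace k A ->
  is_subspace k B -> A \subset Z -> B \subset Z -> residue A != residue B ->
  (residue A <= V)%MS -> (residue B <= V)%MS -> (residue Z <= V)%MS.
Proof.
move=> sZ sA sB AZ BZ nAB AV BV.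
suff s : (residue Z <= residue A + residue B)%MS.
  by apply: submx_trans s _; rewrite addsmx_sub AV.
have sAB : (residue A + residue B <= residue Z)%MS by rewrite addsmx_sub !residueS.
rewrite -(geq_leqif (mxrank_leqif_sup sAB)) (rank_residue sZ).
rewrite -[X in (X < _)%N](rank_residue sA) ltnNge.
rewrite (geq_leqif (mxrank_leqif_sup (addsmxSl _ _))) addsmx_sub submx_refl /=.
by apply: contra nAB => s; rewrite eq_sym; apply/eqP/(residue_leP sB sA).
Qed.

(** As [Z] leaves [Q], the two meet exactly in [A], which therefore contains, and equals, [B]. So
    [A] lies in both [X] and [Y], which meet exactly in [P]. *)
Lemma star_triple k X Y Z P Q A B : is_subspace k.+1 X -> is_subspace k.+1 Y ->
  is_subspace k.+1 Z -> is_subspace k P -> is_subspace k.+2 Q ->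
  is_subspace k A -> is_subspace k B ->
  P \subset X -> P \subset Y -> X \subset Q -> Y \subset Q ->
  A \subset X -> A \subset Z -> B \subset Y -> B \subset Z ->
  residue X != residue Y -> ~~ (residue Z <= residue Q)%MS -> P \subset Z.
Proof.
move=> sX sY sZ sP sQ sA sB PX PY XQ YQ AX AZ BY BZ nXY nZQ.
have ZQ := hyperplane_cap sZ sA sQ AZ (subset_trans AX XQ) nZQ.
have BA : B \subset A by rewrite -ZQ subsetI BZ (subset_trans BY YQ).
have eBA := subspace_eq sB sA BA.
have nXY' : ~~ (residue X <= residue Y)%MS.
  by apply: contra nXY => s; apply/eqP/(residue_leP sX sY).
have XY := hyperplane_cap sX sP sY PX PY nXY'.
have AP : A \subset P by rewrite -XY subsetI AX -eBA.
by rewrite -(subspace_eq sA sP AP).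
Qed.

(** If [A] and [B] are incongruent they span [Z], and both lie in [Q]. If they are congruent, their
    residue lies in those of [X] and [Y], hence is the residue of [P], which is excluded. *)
Lemma top_triple k X Y Z P Q A B : is_subspace k.+1 X -> is_subspace k.+1 Y ->
  is_subspace k.+1 Z -> is_subspace k P -> is_subspace k.+2 Q ->
  is_subspace k A -> is_subspace k B ->
  P \subset X -> P \subset Y -> X \subset Q -> Y \subset Q ->
  A \subset X -> A \subset Z -> B \subset Y -> B \subset Z ->
  residue X != residue Y -> ~~ (residue P <= residue Z)%MS -> Z \subset Q.
Proof.
move=> sX sY sZ sP sQ sA sB PX PY XQ YQ AX AZ BY BZ nXY nPZ.
have [eAB | nAB] := eqVneq (residue A) (residue B); last first.
  exact: hyperplane_join sZ sA sB sQ AZ BZ nAB (subset_trans AX XQ) (subset_trans BY YQ).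
case/negP: nPZ; have AP : (residue A <= residue P)%MS.
  apply: (residue_cap sX sY sP PX PY nXY); first exact: residueS.
  by rewrite eAB residueS.
by have /(residue_leP sA sP) <- := AP; rewrite residueS.
Qed.

Lemma clique_meet k C X Y : clique k C -> is_subspace k.+1 X -> X \in C -> Y \in C ->
  exists P, [/\ is_subspace k P, P \subset X & P \subset Y].
Proof.
move=> cC sX XC YC; have [<- | nXY] := eqVneq X Y; last exact: cC.
by have [P sP PX] := exists_sub sX (leqnSn k); exists P.
Qed.

(* If all members of C lie between P and Q modulo the maximal ideal, they occupy at
   most p + 1 residue classes. *)
Lemma pencil_clique k C X Y P Q : is_subspace k.+1 X -> is_subspace k.+1 Y ->
  is_subspace k P -> is_subspace k.+2 Q -> P \subset X -> P \subset Y ->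
  X \subset Q -> Y \subset Q -> residue X != residue Y -> (k.+1 <= n - k.+1)%N ->
  (forall Z, Z \in C -> is_subspace k.+1 Z) -> clique k C ->
  (forall Z, Z \in C -> (residue P <= residue Z)%MS /\ (residue Z <= residue Q)%MS) ->
  (#|C| <= (chain_char K).+1 * card_rad K ^ (n - k.+1))%N.
Proof.
move=> sX sY sP sQ PX PY XQ YQ nXY kn sC cC PCQ.
have /residue_subPn[x xX nx] : ~~ (residue X <= residue P)%MS.
  by apply/negP=> /mxrankS; rewrite (rank_residue sX) (rank_residue sP) ltnn.
have nyX : ~~ (residue Y <= residue X)%MS.
  by apply: contra nXY => s; rewrite eq_sym; apply/eqP/(residue_leP sY sX).
have /residue_subPn[y yY ny] : ~~ (residue Y <= residue P)%MS.
  by apply/negP=> /mxrankS; rewrite (rank_residue sY) (rank_residue sP) ltnn.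
have nxY : ~~ (x^r <= residue Y)%MS.
  apply: contra nx => xrY.
  by apply: (residue_cap sX sY sP PX PY nXY) => //; apply: mem_residue.
have decX : (residue X <= residue P + x^r)%MS.
  apply/residue_subP=> z zX.
  have [a aP [c ->]] := hyperplane_decomp sX sP PX xX nx zX.
  rewrite map_mxD map_mxZ addmx_sub_adds ?scalemx_sub ?submx_refl //.
  exact: mem_residue.
have decY : (residue Y <= residue P + y^r)%MS.
  apply/residue_subP=> z zY.
  have [a aP [c ->]] := hyperplane_decomp sY sP PY yY ny zY.
  rewrite map_mxD map_mxZ addmx_sub_adds ?scalemx_sub ?submx_refl //.
  exact: mem_residue.
have decQ : (residue Q <= residue P + x^r + y^r)%MS.
  apply: (residue_join sQ sX sY XQ YQ nXY).
    exact: submx_trans decX (addsmxSl _ _).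
  by apply: submx_trans decY _; rewrite addsmxS // addsmxSl.
(* Representatives of the p + 1 points of the projective line of [Q] over [P] modulo p; [None] is
   the point at infinity. *)
pose w (o : option 'k K) := if o is Some t then x^r - t *: y^r else y^r.
pose cl Z := [pick t | (x^r - t *: y^r <= residue Z)%MS].
have nw o : ~~ (w o <= residue P)%MS.
  case: o => [t|] //=; apply: contra nxY => s.
  rewrite -[x^r](subrK (t *: y^r)) addmx_sub ?scalemx_sub ?mem_residue //.
  exact: submx_trans s (residueS PY).
have wZ Z : Z \in C -> (w (cl Z) <= residue Z)%MS.
  move=> ZC; have [PZ ZQ] := PCQ Z ZC; rewrite /w /cl; case: pickP => //= none.
  have /residue_subPn[z zZ nz] : ~~ (residue Z <= residue P)%MS.
    by apply/negP=> /mxrankS; rewrite (rank_residue (sC Z ZC)) (rank_residue sP) ltnn.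
  have zrZ := mem_residue zZ.
  have /sub_addsmxP[[u b]] := submx_trans (submx_trans zrZ ZQ) decQ.
  have /sub_addsmxP[[v a] /= ->] := submxMl u (residue P + x^r)%MS.
  rewrite [a]mx11_scalar [b]mx11_scalar !mul_scalar_mx => ez.
  have vZ : (v *m residue P <= residue Z)%MS by apply: submx_trans (submxMl _ _) PZ.
  have abZ : ((a 0 0 *: x^r + b 0 0 *: y^r)%R <= residue Z)%MS.
    suff -> : a 0 0 *: x^r + b 0 0 *: y^r = z^r - v *m residue P.
      by rewrite addmx_sub // eqmx_opp.
    by apply/esym/eqP; rewrite subr_eq ez -addrA addrC.
  (* Modulo [P] the residue of [z] is a x + b y: for a = 0 it is the point [None], otherwise the
     parameter -b/a contradicts [none]. *)
  have [a0 | na] := eqVneq (a 0 0) 0.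
    have nb : b 0 0 != 0.
      apply: contraNneq nz => b0.
      by rewrite ez a0 b0 !scale0r !addr0 submxMl.
    by rewrite a0 scale0r add0r eqmx_scale in abZ.
  have := none (- (b 0 0 / a 0 0)); rewrite /= scaleNr opprK => /negP[].
  have -> : x^r + (b 0 0 / a 0 0) *: y^r = (a 0 0)^-1 *: (a 0 0 *: x^r + b 0 0 *: y^r).
    by rewrite scalerDr !scalerA mulVf // scale1r [_ / _]mulrC.
  exact: scalemx_sub.
have eqZ Z Z' : Z \in C -> Z' \in C -> cl Z = cl Z' -> residue Z = residue Z'.
  move=> ZC Z'C e; have sZ := sC Z ZC; have sZ' := sC Z' Z'C.
  have [PZ _] := PCQ Z ZC; have [PZ' _] := PCQ Z' Z'C.
  apply/(residue_leP sZ sZ').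
  have s : (residue P + w (cl Z) <= residue Z)%MS by rewrite addsmx_sub PZ wZ.
  apply: (@submx_trans _ _ _ _ _ _ (residue P + w (cl Z))%MS); last first.
    by rewrite addsmx_sub PZ' e wZ.
  rewrite -(geq_leqif (mxrank_leqif_sup s)) (rank_residue sZ).
  rewrite -[X in (X < _)%N](rank_residue sP) ltnNge.
  rewrite (geq_leqif (mxrank_leqif_sup (addsmxSl _ _))) addsmx_sub submx_refl /=.
  exact: nw.
have -> : #|C| = (\sum_(o : option 'k K) #|[set Z in C | cl Z == o]|)%N.
  rewrite -sum1_card (partition_big cl xpredT) //=; apply: eq_bigr => o _.
  by rewrite -sum1dep_card.
have -> : (chain_char K).+1 = #|{: option 'k K}|.
  by rewrite card_option card_Fp ?chain_char_prime.
rewrite -sum_nat_const; apply: leq_sum => o _.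
have [-> | [Z0]] := set_0Vmem [set Z in C | cl Z == o]; first by rewrite cards0.
rewrite inE => /andP[Z0C /eqP cl0].
apply: (card_residue_clique (sC Z0 Z0C) kn).
  move=> Z; rewrite inE => /andP[ZC /eqP clZ]; split; first exact: sC.
  by apply: eqZ => //; rewrite clZ.
by move=> Z Z'; rewrite !inE => /andP[ZC _] /andP[Z'C _]; apply: cC.
Qed.

(** Each of the three pairs among [X], [Y], [Z] allows one application of [star_triple] or
    [top_triple] to a further member [W]. If all three failed, [W] would be congruent to both [X]
    and [Y]. *)
Theorem large_clique k C : (k.+1 <= n - k.+1)%N -> (k.+2 <= n)%N ->
  (forall Z, Z \in C -> is_subspace k.+1 Z) -> clique k C ->
  ((chain_char K).+1 * card_rad K ^ (n - k.+1) < #|C|)%N ->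
  (exists2 P, is_subspace k P & C \subset star k.+1 P) \/
  (exists2 Q, is_subspace k.+2 Q & C \subset top k.+1 Q).
Proof.
move=> kn k2n sC cC big.
have meet X Y XC YC := @clique_meet k C X Y cC (sC X XC) XC YC.
have [X [Y [XC YC nXY]]] : exists X Y, [/\ X \in C, Y \in C & residue X != residue Y].
  have /card_gt0P[X XC] : (0 < #|C|)%N by apply: leq_ltn_trans big.
  case: (pickP [pred Y in C | residue X != residue Y]) => [Y /andP[YC nXY] | all].
    by exists X, Y.
  move: big; rewrite ltnNge => /negP[]; rewrite mulSn.
  apply: leq_trans (leq_addr _ _); apply: (card_residue_clique (sC X XC) kn) => // Y YC.
  split; first exact: sC.
  by have := all Y; rewrite /= YC => /negbFE/eqP.
have sX := sC X XC; have sY := sC Y YC.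
have [P [sP PX PY]] := meet X Y XC YC.
have [Q [sQ XQ YQ]] := common_sup sX sY sP PX PY k2n.
have [Z /andP[ZC nZQ] | Q_all] := pickP [pred Z in C | ~~ (residue Z <= residue Q)%MS].
  left; exists P => //.
  have sZ := sC Z ZC.
  have [A [sA AX AZ]] := meet X Z XC ZC; have [B [sB BY BZ]] := meet Y Z YC ZC.
  have PZ := star_triple sX sY sZ sP sQ sA sB PX PY XQ YQ AX AZ BY BZ nXY nZQ.
  have [Q1 [sQ1 XQ1 ZQ1]] := common_sup sX sZ sP PX PZ k2n.
  have [Q2 [sQ2 YQ2 ZQ2]] := common_sup sY sZ sP PY PZ k2n.
  have nXZ : residue X != residue Z by apply: contraNneq nZQ => <-; apply: residueS.
  have nYZ : residue Y != residue Z by apply: contraNneq nZQ => <-; apply: residueS.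
  have nQ1 : residue Q != residue Q1 by apply: contraNneq nZQ => ->; apply: residueS.
  have nQ2 : residue Q != residue Q2 by apply: contraNneq nZQ => ->; apply: residueS.
  apply/subsetP=> W WC; have sW := sC W WC; rewrite inE sW /=.
  have [A1 [sA1 A1X A1W]] := meet X W XC WC; have [A2 [sA2 A2Y A2W]] := meet Y W YC WC.
  have [A3 [sA3 A3Z A3W]] := meet Z W ZC WC.
  have [WQ | nWQ] := boolP (residue W <= residue Q)%MS; last first.
    exact: star_triple sX sY sW sP sQ sA1 sA2 PX PY XQ YQ A1X A1W A2Y A2W nXY nWQ.
  have [WQ1 | nWQ1] := boolP (residue W <= residue Q1)%MS; last first.
    exact: star_triple sX sZ sW sP sQ1 sA1 sA3 PX PZ XQ1 ZQ1 A1X A1W A3Z A3W nXZ nWQ1.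
  have [WQ2 | nWQ2] := boolP (residue W <= residue Q2)%MS; last first.
    exact: star_triple sY sZ sW sP sQ2 sA2 sA3 PY PZ YQ2 ZQ2 A2Y A2W A3Z A3W nYZ nWQ2.
  (* Modulo p, [Q] and [Q1] meet in [X], and [Q] and [Q2] meet in [Y]. *)
  have WX := residue_cap sQ sQ1 sX XQ XQ1 nQ1 WQ WQ1.
  have WY := residue_cap sQ sQ2 sY YQ YQ2 nQ2 WQ WQ2.
  case/eqP: nXY; have /(residue_leP sW sX) <- := WX.
  by have /(residue_leP sW sY) <- := WY.
have CQ Z : Z \in C -> (residue Z <= residue Q)%MS.
  by move=> ZC; have := Q_all Z; rewrite /= ZC => /negbFE.
have [Z /andP[ZC nPZ] | P_all] := pickP [pred Z in C | ~~ (residue P <= residue Z)%MS].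
  right; exists Q => //.
  have sZ := sC Z ZC.
  have [A [sA AX AZ]] := meet X Z XC ZC; have [B [sB BY BZ]] := meet Y Z YC ZC.
  have ZQ := top_triple sX sY sZ sP sQ sA sB PX PY XQ YQ AX AZ BY BZ nXY nPZ.
  have nXZ : residue X != residue Z by apply: contraNneq nPZ => <-; apply: residueS.
  have nYZ : residue Y != residue Z by apply: contraNneq nPZ => <-; apply: residueS.
  have nPA : residue P != residue A by apply: contraNneq nPZ => ->; apply: residueS.
  have nPB : residue P != residue B by apply: contraNneq nPZ => ->; apply: residueS.
  apply/subsetP=> W WC; have sW := sC W WC; rewrite inE sW /=.
  have [A1 [sA1 A1X A1W]] := meet X W XC WC; have [A2 [sA2 A2Y A2W]] := meet Y W YC WC.
  have [A3 [sA3 A3Z A3W]] := meet Z W ZC WC.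
  have [PW | nPW] := boolP (residue P <= residue W)%MS; last first.
    exact: top_triple sX sY sW sP sQ sA1 sA2 PX PY XQ YQ A1X A1W A2Y A2W nXY nPW.
  have [AW | nAW] := boolP (residue A <= residue W)%MS; last first.
    exact: top_triple sX sZ sW sA sQ sA1 sA3 AX AZ XQ ZQ A1X A1W A3Z A3W nXZ nAW.
  have [BW | nBW] := boolP (residue B <= residue W)%MS; last first.
    exact: top_triple sY sZ sW sB sQ sA2 sA3 BY BZ YQ ZQ A2Y A2W A3Z A3W nYZ nBW.
  (* Modulo p, [P] and [A] span [X], and [P] and [B] span [Y]. *)
  have XW := residue_join sX sP sA PX AX nPA PW AW.
  have YW := residue_join sY sP sB PY BY nPB PW BW.
  case/eqP: nXY; have /(residue_leP sX sW) -> := XW.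
  by have /(residue_leP sY sW) -> := YW.
have CP Z : Z \in C -> (residue P <= residue Z)%MS.
  by move=> ZC; have := P_all Z; rewrite /= ZC => /negbFE.
move: big; rewrite ltnNge => /negP[].
apply: (pencil_clique sX sY sP sQ PX PY XQ YQ nXY kn sC cC) => Z ZC.
by split; [apply: CP | apply: CQ].
Qed.

End LargeCliques.

(** * Action of automorphisms on stars *)

Section Automorphisms.

Variables (K : chainRing) (n : nat).
Implicit Types X Y Z A B P Q V W T : {set 'rV[K]_n}.
Implicit Types f g : {set 'rV[K]_n} -> {set 'rV[K]_n}.

(** Unlike adjacency, reflexive on (k+1)-subspaces, so that any two members of a star are
    related. *)
Definition meets k X Y := exists P, [/\ is_subspace k P, P \subset X & P \subset Y].

(** Maps act on all sets and are constrained on subspaces only, so one type serves all ranks and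
    duality; surjectivity follows by finiteness. *)
Definition permutes_subspaces k f :=
  (forall X, is_subspace k X -> is_subspace k (f X)) /\
  (forall X Y, is_subspace k X -> is_subspace k Y -> f X = f Y -> X = Y).

Definition adj_aut k f := permutes_subspaces k.+1 f /\
  forall X Y, is_subspace k.+1 X -> is_subspace k.+1 Y ->
    meets k (f X) (f Y) <-> meets k X Y.

Definition preserves_stars k f := forall P, is_subspace k P ->
  exists2 P', is_subspace k P' & f @: star k.+1 P = star k.+1 P'.

Lemma permutes_surj k f Y : permutes_subspaces k f -> is_subspace k Y ->
  exists2 X, is_subspace k X & f X = Y.
Proof.
move=> [fsub finj] sY; pose G := [set X : {set 'rV[K]_n} | is_subspace k X].
have f_inj : {in G &, injective f} by move=> X1 X2; rewrite !inE; apply: finj.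
have fG : f @: G = G.
  apply/eqP; rewrite eqEcard card_in_imset // leqnn andbT.
  by apply/subsetP=> _ /imsetP[X XG ->]; rewrite inE in XG; rewrite inE fsub.
have : Y \in f @: G by rewrite fG inE.
by case/imsetP=> X; rewrite inE => sX ->; exists X.
Qed.

Lemma mem_imset_star k f P X : permutes_subspaces k.+1 f -> is_subspace k.+1 X ->
  (f X \in f @: star k.+1 P) = (P \subset X).
Proof.
move=> [fsub finj] sX; apply/imsetP/idP => [[Y] | PX]; last by exists X; rewrite // inE sX.
by rewrite inE => /andP[sY PY] /(finj _ _ sX sY) ->.
Qed.

Lemma card_imset_star k f P : permutes_subspaces k.+1 f ->
  #|f @: star k.+1 P| = #|star k.+1 P|.
Proof.
move=> [_ finj]; apply: card_in_imset => X Y.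
by rewrite !inE => /andP[sX _] /andP[sY _]; apply: finj.
Qed.

(** The image is a clique as large as a star, so it lies in a star or a top. Counting turns the
    inclusion into an equality, and a star fits into a top only if n - k <= k + 2. *)
Lemma star_image k f P : adj_aut k f -> (0 < k)%N -> (k.+1 <= n - k.+1)%N ->
  is_subspace k P ->
  (exists2 P', is_subspace k P' & f @: star k.+1 P = star k.+1 P') \/
  (n = k.+1.*2 /\ exists2 Q, is_subspace k.+2 Q & f @: star k.+1 P = top k.+1 Q).
Proof.
move=> [pf af] k0 kn sP; have [fsub finj] := pf.
have kn1 : (k < n)%N by lia.
have p1 : (0 < (chain_char K).-1)%N.
  by rewrite -subn1 subn_gt0 prime_gt1 ?chain_char_prime.
have sf Z : Z \in f @: star k.+1 P -> is_subspace k.+1 Z.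
  by case/imsetP=> X; rewrite inE => /andP[sX _] ->; apply: fsub.
have cf : clique k (f @: star k.+1 P).
  move=> _ _ /imsetP[X + ->] /imsetP[Y + ->] _; rewrite !inE.
  by move=> /andP[sX PX] /andP[sY PY]; apply/af => //; exists P.
have big : ((chain_char K).+1 * card_rad K ^ (n - k.+1) < #|f @: star k.+1 P|)%N.
  by rewrite card_imset_star // card_star_gt //; lia.
have [|[P' sP' sub] | [Q sQ sub]] := large_clique kn _ sf cf big; first by lia.
  left; exists P' => //; apply/eqP; rewrite eqEcard sub card_imset_star //.
  by rewrite -(leq_pmul2r p1) (card_star sP kn1) (card_star sP' kn1) leqnn.
have le := subset_leq_card sub; rewrite card_imset_star // in le.
have ct := card_top sQ; have cs := card_star sP kn1.
rewrite -(leq_pmul2r p1) ct cs in le.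
have nk : n = k.+1.*2.
  apply/eqP; rewrite eqn_leq [X in _ && X](_ : _ = true) ?andbT; last by lia.
  rewrite leqNgt; apply: contraL le => lt; rewrite -ltnNge.
  have e1 : (0 < card_rad K ^ k.+1)%N by rewrite expn_gt0 card_rad_gt0.
  have pp := prime_gt1 (chain_char_prime K).
  apply: (@leq_trans (card_rad K ^ k.+1 * (chain_char K ^ (n - k)).-1)).
    rewrite ltn_pmul2l // -ltnS !prednK ?expn_gt0 ?(ltnW pp) // ltn_exp2l //; lia.
  by rewrite leq_mul2r leq_pexp2l ?card_rad_gt0 ?orbT //; lia.
right; split=> //; exists Q => //; apply/eqP; rewrite eqEcard sub card_imset_star //.
rewrite -(leq_pmul2r p1) ct cs.
have -> : (n - k.+1 = k.+1)%N by lia.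
have -> : (n - k = k.+2)%N by lia.
exact: leqnn.
Qed.

(* Two vertices through P that are distinct modulo the maximal ideal meet exactly in P. *)
Lemma star_sub k P P' : is_subspace k P -> is_subspace k P' -> (k.+1 < n)%N ->
  star k.+1 P \subset star k.+1 P' -> P = P'.
Proof.
move=> sP sP' kn /subsetP sub.
have [|X sX PX] := @exists_sup _ _ k.+1 _ _ sP; first by rewrite leqnSn ltnW.
have /residue_subPn[y _ ny] : ~~ (residue [set: 'rV[K]_n] <= residue X)%MS.
  apply/negP=> /mxrankS.
  by rewrite (rank_residue sX) (rank_residue (full_subspace K n)) leqNgt kn.
have nyP : ~~ (y^r <= residue P)%MS.
  by apply: contra ny => s; apply: submx_trans s (residueS PX).
have [Y [sY PY yY _ _]] := subspace_extend sP nyP.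
have nXY : ~~ (residue Y <= residue X)%MS.
  by apply: contra ny => s; apply: submx_trans (mem_residue yY) s.
have XY := hyperplane_cap sY sP sX PY PX nXY.
have := sub X; have := sub Y; rewrite !inE sX sY PX PY /= => /(_ isT) P'Y /(_ isT) P'X.
by apply/esym/(subspace_eq sP' sP); rewrite -XY subsetI P'Y.
Qed.

Lemma exists_hyperplane_through k X x : is_subspace k.+2 X -> x \in X -> x^r != 0 ->
  exists P, [/\ is_subspace k.+1 P, P \subset X & x \in P].
Proof.
move=> sX xX x0.
have [|P [sP xP PX]] := interpolate (point_subspace x0) sX (point_sub sX xX) (k := k.+1).
  by rewrite leqnSn.
by exists P; split=> //; apply: (subsetP xP); apply: mem_point.
Qed.

(** [X] is moved to [Y] by exchange. Let [D] be common to [Y] and the current vertex, and [v] a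
    vector of [Y] outside [D] modulo p. A hyperplane [H] of the vertex that contains [D] and avoids
    [v] gives the neighbour H + v, which shares D + v with [Y]. *)
Lemma graph_connected k (S : {set 'rV[K]_n} -> Prop) :
  (forall X Y, is_subspace k.+1 X -> is_subspace k.+1 Y -> meets k X Y -> S X -> S Y) ->
  forall X Y, is_subspace k.+1 X -> is_subspace k.+1 Y -> S X -> S Y.
Proof.
move=> Sadj X Y sX sY.
have main j D X1 : is_subspace k.+1 X1 -> is_subspace (k.+1 - j) D -> D \subset X1 ->
    D \subset Y -> S X1 -> S Y.
  elim: j D X1 => [|j IH] D X1 sX1 sD DX DY SX.
    rewrite subn0 in sD.
    by rewrite -(subspace_eq sD sY DY) (subspace_eq sD sX1 DX).
  (* Truncated subtraction: in the first case both ranks are 0 and [D] stays the same. *)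
  have [kj | jk] := leqP k.+1 j.
    by apply: (IH D X1) => //; have -> : (k.+1 - j = k.+1 - j.+1)%N by lia.
  have ej : ((k.+1 - j.+1).+1 = k.+1 - j)%N by lia.
  have /residue_subPn[v vY nv] : ~~ (residue Y <= residue D)%MS.
    by apply/negP=> /mxrankS; rewrite (rank_residue sY) (rank_residue sD); lia.
  have [|H [sH DH HX nvH]] := interpolate_avoiding sD sX1 DX (k := k) _ nv.
    by rewrite ltnSn andbT; lia.
  have [X2 [sX2 HX2 vX2 _ _]] := subspace_extend sH nvH.
  have [D' [sD' DD' vD' _ dD']] := subspace_extend sD nv.
  apply: (IH D' X2) => //; first by rewrite -ej.
  - exact: extend_sub sD sX2 dD' (subset_trans DH HX2) vX2.
  - exact: extend_sub sD sY dD' DY vY.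
  - by apply: (Sadj X1) => //; exists H.
apply: (main k.+1 [set 0]); rewrite ?subnn ?zero_subspace //.
  by rewrite sub1set (subspace0 sX).
by rewrite sub1set (subspace0 sY).
Qed.

Lemma star_cap k X P P' : is_subspace k.+1 X -> is_subspace k P -> is_subspace k P' ->
  P \subset X -> P' \subset X -> residue P != residue P' ->
  star k.+1 P :&: star k.+1 P' = [set X].
Proof.
move=> sX sP sP' PX P'X nPP'; apply/setP=> Z; rewrite !inE.
apply/andP/eqP => [[/andP[sZ PZ] /andP[_ P'Z]] | ->]; last by rewrite sX PX.
by apply/esym/(subspace_eq sX sZ); apply: hyperplane_join sX sP sP' sZ PX P'X nPP' PZ P'Z.
Qed.

(** If [X] is in the intersection, adjoining to [P] a vector of [Q] outside [X] modulo p gives a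
    second member. Two stars can meet in one vertex, so this tells tops from stars. *)
Lemma star_top_cap k X P Q : is_subspace k.+1 X -> is_subspace k P -> is_subspace k.+2 Q ->
  star k.+1 P :&: top k.+1 Q <> [set X].
Proof.
move=> sX sP sQ /setP e.
have := e X; rewrite !inE eqxx => /andP[/andP[_ PX] /andP[_ XQ]].
have /residue_subPn[y yQ ny] : ~~ (residue Q <= residue X)%MS.
  by apply/negP=> /mxrankS; rewrite (rank_residue sQ) (rank_residue sX) ltnn.
have nyP : ~~ (y^r <= residue P)%MS.
  by apply: contra ny => s; apply: submx_trans s (residueS PX).
have [Y [sY PY yY _ dY]] := subspace_extend sP nyP.
have YQ := extend_sub sP sQ dY (subset_trans PX XQ) yQ.
have := e Y; rewrite !inE sY PY YQ => /esym/eqP eYX.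
by case/negP: ny; rewrite -eYX mem_residue.
Qed.

Lemma exists_far_hyperplane k X P : is_subspace k.+2 X -> is_subspace k.+1 P ->
  P \subset X ->
  exists P', [/\ is_subspace k.+1 P', P' \subset X & residue P != residue P'].
Proof.
move=> sX sP PX; have /residue_subPn[x xX nx] : ~~ (residue X <= residue P)%MS.
  by apply/negP=> /mxrankS; rewrite (rank_residue sX) (rank_residue sP) ltnn.
have [|P' [sP' P'X xP']] := exists_hyperplane_through sX xX.
  by apply: contraNneq nx => ->; apply: sub0mx.
by exists P'; split=> //; apply: contraNneq nx => ->; apply: mem_residue.
Qed.

(** Incongruent centres inside one vertex have stars meeting in that vertex alone, so their images
    have the same type. A third hyperplane settles congruent centres, and connectedness extends the
    result to all. *)
Lemma stars_or_tops k f : adj_aut k f -> (0 < k)%N -> n = k.+1.*2 ->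
  preserves_stars k f \/
  (forall P, is_subspace k P ->
     exists2 Q, is_subspace k.+2 Q & f @: star k.+1 P = top k.+1 Q).
Proof.
move=> af k0 nk; have [pf _] := af.
have kn : (k.+1 <= n - k.+1)%N by lia.
pose tau P := exists2 P', is_subspace k P' & f @: star k.+1 P = star k.+1 P'.
have tauP P : is_subspace k P -> tau P \/
    exists2 Q, is_subspace k.+2 Q & f @: star k.+1 P = top k.+1 Q.
  by move=> sP; have [t | [_ t]] := star_image af k0 kn sP; [left | right].
have far X P P' : is_subspace k.+1 X -> is_subspace k P -> is_subspace k P' ->
    P \subset X -> P' \subset X -> residue P != residue P' -> tau P -> tau P'.
  move=> sX sP sP' PX P'X nPP' [P1 sP1 e1]; have [// | [Q sQ e2]] := tauP P' sP'.
  case: (star_top_cap (pf.1 X sX) sP1 sQ); rewrite -e1 -e2.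
  rewrite -imsetI; last first.
    move=> Y Z; rewrite !inE => /andP[sY _] /andP[sZ _]; exact: pf.2.
  by rewrite (star_cap sX sP sP' PX P'X nPP') imset_set1.
have near X P P' : is_subspace k.+1 X -> is_subspace k P -> is_subspace k P' ->
    P \subset X -> P' \subset X -> tau P -> tau P'.
  move=> sX sP sP' PX P'X tP.
  have [e | nPP'] := eqVneq (residue P) (residue P'); last exact: (far X P).
  (* The third hyperplane exists because k >= 1: a centre of rank 0 has no incongruent companion. *)
  case: (k) k0 sX sP sP' @tau tauP far tP => // j _ sX sP sP' tau tauP far tP.
  have [P2 [sP2 P2X nPP2]] := exists_far_hyperplane sX sP PX.
  apply: (far X P2) => //; first by rewrite -e eq_sym.
  exact: (far X P).
have conn := @graph_connected k (fun X => forall P, is_subspace k P -> P \subset X -> tau P).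
have {}conn : forall X Y, is_subspace k.+1 X -> is_subspace k.+1 Y ->
    (forall P, is_subspace k P -> P \subset X -> tau P) ->
    forall P, is_subspace k P -> P \subset Y -> tau P.
  apply: conn => X Y sX sY [P [sP PX PY]] tX P' sP' P'Y.
  exact: (near Y P) (tX P sP PX).
have sup P : is_subspace k P -> exists2 X, is_subspace k.+1 X & P \subset X.
  by move=> sP; apply: exists_sup sP _; lia.
have tall P P' : is_subspace k P -> is_subspace k P' -> tau P -> tau P'.
  move=> sP sP' tP; have [X sX PX] := sup P sP; have [X' sX' P'X'] := sup P' sP'.
  by apply: (conn X X') => // P2 sP2 P2X; apply: (near X P).
pose t P := [exists P' : {set 'rV[K]_n},
  is_subspace k P' && (f @: star k.+1 P == star k.+1 P')].
have tE P : reflect (tau P) (t P).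
  apply: (iffP existsP) => [[P' /andP[sP' /eqP e]] | [P' sP' e]]; first by exists P'.
  by exists P'; rewrite sP' e eqxx.
have [/forall_inP all | /forall_inPn[P0 sP0 /tE nt0]] :=
    boolP [forall (P | is_subspace k P), t P].
  by left=> P sP; apply/tE/all.
by right=> P sP; have [tP | //] := tauP P sP; case: nt0; apply: tall tP.
Qed.


End Automorphisms.

(** * Duality, and descent to subspaces of smaller rank *)

Section Descent.

Variables (K : chainRing) (n : nat).
Implicit Types X Y Z A B P Q V W T : {set 'rV[K]_n}.
Implicit Types f g : {set 'rV[K]_n} -> {set 'rV[K]_n}.

Lemma dual_subspace_half k X : n = k.+1.*2 -> is_subspace k.+1 X -> is_subspace k.+1 (dual X).
Proof.
by move=> nk sX; have := dual_subspace sX; have -> : (n - k.+1 = k.+1)%N by lia.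
Qed.

Lemma meets_dual k X Y : n = k.+1.*2 -> is_subspace k.+1 X -> is_subspace k.+1 Y ->
  meets k X Y -> meets k (dual X) (dual Y).
Proof.
move=> nk sX sY [P [sP PX PY]].
have [|Q [sQ XQ YQ]] := common_sup sX sY sP PX PY; first by lia.
exists (dual Q); rewrite !dualS //; split=> //.
have := dual_subspace sQ.
by have -> : (n - k.+2 = k)%N by lia.
Qed.

Lemma dual_adj_aut k f : n = k.+1.*2 -> adj_aut k f -> adj_aut k (fun X => dual (f X)).
Proof.
move=> nk [[fsub finj] af]; split; first split=> [X sX | X Y sX sY /(congr1 (@dual K n))].
- exact/(dual_subspace_half nk)/fsub.
- by rewrite (dualK (fsub _ sX)) (dualK (fsub _ sY)); apply: finj.
move=> X Y sX sY /=; have [fX fY] := (fsub X sX, fsub Y sY).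
have [dX dY] := (dual_subspace_half nk fX, dual_subspace_half nk fY).
split=> m; last by apply: (meets_dual nk fX fY); apply/(af X Y sX sY).
apply/(af X Y sX sY).
by have := meets_dual nk dX dY m; rewrite (dualK fX) (dualK fY).
Qed.

Lemma dual_preserves_stars k f : n = k.+1.*2 -> permutes_subspaces k.+1 f ->
  (forall P, is_subspace k P ->
     exists2 Q, is_subspace k.+2 Q & f @: star k.+1 P = top k.+1 Q) ->
  preserves_stars k (fun X => dual (f X)).
Proof.
move=> nk [fsub finj] ft P sP; have [Q sQ e] := ft P sP.
exists (dual Q).
  by have := dual_subspace sQ; have -> : (n - k.+2 = k)%N by lia.
rewrite (imset_comp (@dual K n) f) e; apply/setP=> X.
rewrite inE; apply/imsetP/andP => [[Y] | [sX QX]].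
  by rewrite inE => /andP[sY YQ] ->; rewrite dual_subspace_half ?dualS.
exists (dual X); last by rewrite (dualK sX).
by rewrite inE dual_subspace_half // -(dualK sQ) dualS.
Qed.

(** Reads the relation off the subspaces one rank above, where [f] acts, so that [g] inherits it
    through incidence. *)
Lemma meets_sup k P P' : (k.+1 < n)%N -> is_subspace k.+1 P -> is_subspace k.+1 P' ->
  meets k P P' <-> exists X, [/\ is_subspace k.+2 X, P \subset X & P' \subset X].
Proof.
move=> kn sP sP'; split=> [[D [sD DP DP']] | [X [sX PX P'X]]].
  exact: common_sup sP sP' sD DP DP' kn.
exact: common_sub sP sP' sX PX P'X.
Qed.

(** [g] sends the centre of a star to the centre of its image; it is injective since a star
    determines its centre. *)
Lemma star_map k f : permutes_subspaces k.+1 f -> preserves_stars k f -> (k.+1 < n)%N ->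
  exists2 g, permutes_subspaces k g &
    forall P X, is_subspace k P -> is_subspace k.+1 X -> (g P \subset f X) = (P \subset X).
Proof.
move=> pf fs kn.
have gex P : exists P', is_subspace k P ==>
    is_subspace k P' && (f @: star k.+1 P == star k.+1 P').
  have [/fs[P' sP' e] | _] := boolP (is_subspace k P); last by exists P.
  by exists P'; rewrite sP' e eqxx.
pose g P := xchoose (gex P).
have gP P : is_subspace k P ->
    is_subspace k (g P) /\ f @: star k.+1 P = star k.+1 (g P).
  by move=> sP; have /implyP/(_ sP)/andP[? /eqP] := xchooseP (gex P).
have inc P X : is_subspace k P -> is_subspace k.+1 X -> (g P \subset f X) = (P \subset X).
  move=> sP sX; have [sgP e] := gP P sP.
  by rewrite -(mem_imset_star P pf sX) e inE pf.1.
exists g => //; split=> [P /gP[] // | P P' sP sP' eg].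
apply: (star_sub sP sP' kn); apply/subsetP=> X; rewrite !inE => /andP[sX PX].
by rewrite sX -inc // -eg inc.
Qed.

Lemma star_map_adj k f g : permutes_subspaces k.+2 f -> permutes_subspaces k.+1 g ->
  (k.+2 < n)%N ->
  (forall P X, is_subspace k.+1 P -> is_subspace k.+2 X ->
     (g P \subset f X) = (P \subset X)) ->
  adj_aut k g.
Proof.
move=> pf pg kn inc; split=> // P P' sP sP'.
have [sgP sgP'] := (pg.1 P sP, pg.1 P' sP').
rewrite !meets_sup ?(ltnW kn) //; split=> [[X' [sX']] | [X [sX PX P'X]]].
  by have [X sX <-] := permutes_surj pf sX'; rewrite !inc // => PX P'X; exists X.
by exists (f X); rewrite !inc //; split=> //; apply: pf.1.
Qed.

Definition mulS (U : 'M[K]_n) X := [set x *m U | x in X].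

Lemma mulS_rowspan U k (M : 'M[K]_(k, n)) : mulS U (rowspan M) = rowspan (M *m U).
Proof.
apply/setP=> x; apply/imsetP/rowspanP => [[_ /rowspanP[u ->] ->] | [u ->]].
  by exists u; rewrite mulmxA.
by exists (u *m M); rewrite ?mem_rowspan ?mulmxA.
Qed.

Lemma mulS_subspace U k X : U \in unitmx -> is_subspace k X -> is_subspace k (mulS U X).
Proof.
move=> uU /subspaceP[M /unimodularP[N MN] ->]; rewrite mulS_rowspan.
apply/rowspan_subspace/unimodularP; exists (invmx U *m N).
by rewrite -mulmxA mulKVmx.
Qed.

(** Every row of [M] lies in a hyperplane [P] of [X], and g P = P U lies in f X. So f X contains the
    rows of M U, and ranks agree. *)
Lemma mulS_lift k f g U : U \in unitmx -> permutes_subspaces k.+2 f ->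
  (forall P X, is_subspace k.+1 P -> is_subspace k.+2 X ->
     (g P \subset f X) = (P \subset X)) ->
  (forall P, is_subspace k.+1 P -> g P = mulS U P) ->
  forall X, is_subspace k.+2 X -> f X = mulS U X.
Proof.
move=> uU pf inc gU X sX; apply/esym/(subspace_eq (mulS_subspace uU sX) (pf.1 X sX)).
have /subspaceP[M uM eX] := sX; rewrite eX mulS_rowspan -eX.
have sfX := pf.1 X sX.
apply/(rowspan_subP _ (subspace_closed sfX) (subspace0 sfX)) => i.
have rX : row i M \in X by rewrite eX row_rowspan.
have [P [sP PX rP]] := exists_hyperplane_through sX rX (unimodular_row i uM).
have := inc P X sP sX; rewrite PX gU // => /subsetP; apply.
by rewrite row_mul; apply: imset_f.
Qed.

End Descent.

(** * The fundamental theorem of projective geometry *)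

Section Points.

Variables (K : chainRing) (n : nat).
Implicit Types x y z w u v : 'rV[K]_n.

(** Linear independence over the residue field, under which two points span a unique line. *)
Definition far x y := (x^r != 0) && ~~ (y^r <= x^r)%MS.

Lemma far_neq0 x y : far x y -> (x^r != 0) * (y^r != 0).
Proof.
by case/andP=> -> nyx; split=> //; apply: contraNneq nyx => ->; apply: sub0mx.
Qed.

Lemma far_sym x y : far x y -> far y x.
Proof.
move=> fxy; have [x0 y0] := far_neq0 fxy; rewrite /far y0 /=.
case/andP: fxy => _; apply: contra => /sub_rVP[a xa]; apply/sub_rVP; exists a^-1.
rewrite xa scalerA mulVf ?scale1r //.
by apply: contraNneq x0 => a0; rewrite xa a0 scale0r.
Qed.

Lemma far_coord x y j : x^r 0 j != 0 -> y^r 0 j = 0 -> y^r != 0 -> far x y.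
Proof.
move=> xj yj y0; apply/andP; split; first by apply: contraNneq xj => ->; rewrite mxE.
apply: contra y0 => /sub_rVP[a ya]; move: yj; rewrite ya !mxE => /eqP.
rewrite mulf_eq0 => /orP[/eqP -> | ]; first by rewrite scale0r.
by move: xj; rewrite mxE => /negPf ->.
Qed.

Lemma far_comb u v w a b : far v w -> w = a *: u + b *: v -> a \is a GRing.unit.
Proof.
case/andP=> _ nwv e; rewrite unitr_red; apply: contraNneq nwv => a0.
by rewrite e map_mxD !map_mxZ a0 scale0r add0r scalemx_sub.
Qed.

Lemma residue_point x : (residue (rowspan x) :=: x^r)%MS.
Proof. exact: residue_rowspan. Qed.

Lemma pointP x y : reflect (exists a : K, y = a *: x) (y \in rowspan x).
Proof.
apply: (iffP (rowspanP _ _)) => [[a ->] | [a ->]].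
  by exists (a 0 0); rewrite {1}[a]mx11_scalar mul_scalar_mx.
by exists a%:M; rewrite mul_scalar_mx.
Qed.

Lemma point_eq x y : x^r != 0 -> y^r != 0 -> y \in rowspan x -> rowspan y = rowspan x.
Proof.
move=> x0 y0 yx; apply: subspace_eq (point_subspace y0) (point_subspace x0) _.
exact: point_sub (point_subspace x0) yx.
Qed.

Lemma far_line x y : far x y -> exists L,
  [/\ is_subspace 2 L, x \in L, y \in L &
      forall w, w \in L -> exists a b : K, w = a *: x + b *: y].
Proof.
case/andP=> x0 nyx; have nyP : ~~ (y^r <= residue (rowspan x))%MS by rewrite residue_point.
have [L [sL xL yL _ dL]] := subspace_extend (point_subspace x0) nyP.
exists L; split=> // [|w /dL[_ /pointP[a ->] [b ->]]]; last by exists a, b.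
exact: (subsetP xL) (mem_point x).
Qed.

Lemma line_decomp L x y : is_subspace 2 L -> far x y -> x \in L -> y \in L ->
  forall w, w \in L -> exists a b : K, w = a *: x + b *: y.
Proof.
move=> sL fxy xL yL w wL; have [L' [sL' xL' yL' dL']] := far_line fxy.
suff e : L' = L by apply: dL'; rewrite e.
apply: (subspace_eq sL' sL); apply/subsetP=> z /dL'[a [b ->]].
by rewrite (subspaceD sL) // (subspaceZ _ sL).
Qed.

(** [b] is nilpotent, being a multiple of the uniformizer; [c] is its last nonzero power. *)
Lemma zero_divisor (b : K) : red K b = 0 -> exists2 c : K, c != 0 & b * c = 0.
Proof.
move=> b0; have [y by0] := red_eq0 b0.
have ex : exists j, b ^+ j == 0 by exists (len K); rewrite by0 exprMn unif_nilp mul0r.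
case: (ex_minnP ex) => -[|j] /eqP bj minj; first by move/eqP: bj; rewrite expr0 oner_eq0.
exists (b ^+ j); last by rewrite -exprS.
by apply/negP=> /minj; rewrite ltnn.
Qed.

(* Congruent points lie on several common lines, other points on a single one. *)
Lemma far_of_unique_line x y L : (2 < n)%N -> x^r != 0 -> is_subspace 2 L ->
  x \in L -> y \in L ->
  (forall L', is_subspace 2 L' -> x \in L' -> y \in L' -> L' = L) -> far x y.
Proof.
move=> n3 x0 sL xL yL uniqL; rewrite /far x0; apply/negP=> yx.
have sx := point_subspace x0; have xsL := point_sub sL xL.
have /residue_subPn[t tL nt] : ~~ (residue L <= residue (rowspan x))%MS.
  by apply/negP=> /mxrankS; rewrite (rank_residue sL) (rank_residue sx).
have [_ /pointP[a ->] [b yE]] := hyperplane_decomp sL sx xsL tL nt yL.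
have b0 : red K b = 0.
  apply/eqP; apply: contraNT nt => b0; rewrite residue_point.
  have -> : t^r = (red K b)^-1 *: (y^r - red K a *: x^r).
    by rewrite yE map_mxD !map_mxZ addrC addKr scalerA mulVf // scale1r.
  by rewrite scalemx_sub // addmx_sub // eqmx_opp scalemx_sub.
have [c c0 bc] := zero_divisor b0.
have /residue_subPn[t' _ nt'] : ~~ (residue [set: 'rV[K]_n] <= residue L)%MS.
  apply/negP=> /mxrankS.
  by rewrite (rank_residue sL) (rank_residue (full_subspace K n)) leqNgt n3.
(* As b c = 0, [y] is also on the line of [x] and t + c t', and that line differs from [L] because c
   t' is not in [L]. *)
have nu : ~~ ((t + c *: t')^r <= residue (rowspan x))%MS.
  apply/negP=> s; case/negP: (nt).
  have rc : red K c = 0.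
    apply/eqP; apply: contraNT nt' => rc.
    have -> : t'^r = (red K c)^-1 *: ((t + c *: t')^r - t^r).
      by rewrite map_mxD !map_mxZ addrC addKr scalerA mulVf // scale1r.
    rewrite scalemx_sub // addmx_sub ?eqmx_opp //; last exact: mem_residue.
    exact: submx_trans s (residueS xsL).
  by move: s; rewrite map_mxD map_mxZ rc scale0r addr0.
have [L' [sL' xL' uL' _ _]] := subspace_extend sx nu.
have xL'1 : x \in L' by apply: (subsetP xL'); apply: mem_point.
have yL' : y \in L'.
  have -> : y = a *: x + b *: (t + c *: t').
    by rewrite scalerDr scalerA bc scale0r addr0 yE.
  by rewrite (subspaceD sL') // (subspaceZ _ sL').
case/eqP: c0; apply: (extension_disjoint sL nt').
have -> : c *: t' = t + c *: t' - t by rewrite addrC addKr.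
by rewrite (subspaceB sL) // -(uniqL L').
Qed.

(** [h] picks a vector representing the image of each point, so nothing additive is assumed. Vectors
    with zero residue represent no point and their images are left free. *)
Record collineation (h : 'rV[K]_n -> 'rV[K]_n) : Prop := Collineation {
  col_neq0 : forall x, x^r != 0 -> (h x)^r != 0;
  col_far : forall x y, far x y -> far (h x) (h y);
  col_line : forall x y w, far x y -> w^r != 0 ->
    (exists a b : K, w = a *: x + b *: y) ->
    exists a b : K, h w = a *: h x + b *: h y;
  col_point : forall x (a : K), x^r != 0 -> a \is a GRing.unit ->
    h (a *: x) \in rowspan (h x)
}.

(** [h x] generates the image of the point of [x]. Independence is preserved by incidence alone: the
    only common line of two points goes to the only common line of their images. *)
Lemma collineation_exists f g : (2 < n)%N ->
  permutes_subspaces 2 f -> permutes_subspaces 1 g ->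
  (forall P X : {set 'rV[K]_n}, is_subspace 1 P -> is_subspace 2 X ->
     (g P \subset f X) = (P \subset X)) ->
  exists2 h, collineation h & forall x, x^r != 0 -> g (rowspan x) = rowspan (h x).
Proof.
move=> n3 pf pg inc.
have hex x : exists y, (x^r != 0) ==> (y^r != 0) && (g (rowspan x) == rowspan y).
  have [x0 | _] := boolP (x^r != 0); last by exists 0.
  have /subspaceP[y uy ey] := pg.1 _ (point_subspace x0).
  exists y; rewrite ey eqxx andbT -mxrank_eq0 -lt0n.
  by move: uy; rewrite unimodular_red -row_leq_rank.
pose h x := xchoose (hex x).
have hP x : x^r != 0 -> (h x)^r != 0 /\ g (rowspan x) = rowspan (h x).
  by move=> x0; have /implyP/(_ x0)/andP[? /eqP] := xchooseP (hex x).
have hinc x L : x^r != 0 -> is_subspace 2 L -> (h x \in f L) = (x \in L).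
  move=> x0 sL; have [hx0 e] := hP x x0.
  have memE y M : is_subspace 2 M -> (y \in M) = (rowspan y \subset M).
    by move=> sM; apply/idP/idP => [/(point_sub sM) // | /subsetP]; apply; apply: mem_point.
  by rewrite !memE ?pf.1 // -e inc // point_subspace.
have hfar x y : far x y -> far (h x) (h y).
  move=> fxy; have [x0 y0] := far_neq0 fxy; have [L [sL xL yL dL]] := far_line fxy.
  apply: (@far_of_unique_line _ _ (f L)) => //; rewrite ?hinc ?(hP x x0).1 ?pf.1 //.
  move=> L1 sL1; have [L2 sL2 <-] := permutes_surj pf sL1.
  rewrite !hinc // => xL2 yL2; congr f; apply/esym/(subspace_eq sL sL2).
  by apply/subsetP=> z /dL[a [b ->]]; rewrite (subspaceD sL2) // (subspaceZ _ sL2).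
exists h; last by move=> x /hP[].
split=> // [x /hP[] // | x y w fxy w0 [a [b we]] | x a x0 ua].
  have [x0 y0] := far_neq0 fxy; have [L [sL xL yL dL]] := far_line fxy.
  apply: (line_decomp (pf.1 _ sL) (hfar _ _ fxy)); rewrite hinc //.
  by rewrite we (subspaceD sL) // (subspaceZ _ sL).
have ax0 : (a *: x)^r != 0 by rewrite map_mxZ scaler_eq0 negb_or -unitr_red ua.
have [_ <-] := hP x x0.
rewrite -(point_eq x0 ax0); last by apply/pointP; exists a.
by have [_ ->] := hP _ ax0; apply: mem_point.
Qed.

End Points.

(** * Collineations in coordinates *)

Section Fundamental.

Variables (K : chainRing) (n : nat) (o : 'I_n).
Hypothesis n3 : (2 < n)%N.
Implicit Types x y z w u v : 'rV[K]_n.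

Let e i : 'rV[K]_n := delta_mx 0 i.

Lemma eE i j : e i 0 j = (i == j)%:R.
Proof. by rewrite mxE eqxx eq_sym. Qed.

Lemma res_neq0 x i : red K (x 0 i) != 0 -> x^r != 0.
Proof. by apply: contraNneq => /rowP/(_ i); rewrite !mxE => ->. Qed.

Lemma res_neq0P x : x^r != 0 -> exists i, red K (x 0 i) != 0.
Proof. by move=> /rV0Pn[i]; rewrite mxE; exists i. Qed.

Lemma e_neq0 i : (e i)^r != 0.
Proof. by apply: (@res_neq0 _ i); rewrite eE eqxx rmorph1 oner_eq0. Qed.

Lemma far_e x i j : red K (x 0 j) != 0 -> i != j -> far x (e i).
Proof.
move=> xj ij; apply: (@far_coord _ _ _ _ j); last exact: e_neq0; first by rewrite mxE.
by rewrite [LHS]mxE eE (negPf ij) rmorph0.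
Qed.

Lemma drop_coord x i j : (x - x 0 i *: e i) 0 j = if j == i then 0 else x 0 j.
Proof.
rewrite !mxE eqxx /=; case: (eqVneq j i) => [->|_]; first by rewrite mulr1 subrr.
by rewrite mulr0 subr0.
Qed.

Lemma third_index (i j : 'I_n) : exists k, (k != i) && (k != j).
Proof.
apply/existsP; apply: contraLR n3 => /existsPn all; rewrite -leqNgt.
have : (#|'I_n| <= #|[set i; j]|)%N.
  apply: subset_leq_card; apply/subsetP=> k _; rewrite !inE.
  by have := all k; rewrite negb_and !negbK.
by rewrite card_ord => h; apply: leq_trans h _; rewrite cards2; case: (i != j).
Qed.

Lemma support_drop x i (S : {set 'I_n}) : i \in S -> x 0 i != 0 ->
  (#|[set j in S | ((x - x 0 i *: e i) 0 j != 0)%R]| < #|[set j in S | (x 0 j != 0)%R]|)%N.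
Proof.
move=> iS xi; apply: proper_card; apply/properP; split.
  apply/subsetP=> j; rewrite !inE drop_coord; case: (eqVneq j i) => // _.
  by rewrite eqxx andbF.
by exists i; rewrite !inE ?iS ?xi // drop_coord eqxx eqxx.
Qed.

(** Induction on the number of nonzero coordinates: keeping a unit coordinate j, erase another one
    i; then [x] is on the line of the result and [e i]. This serves to show that the matrix of
    images is invertible. *)
Lemma image_in_span h x : collineation h -> x^r != 0 ->
  h x \in rowspan (\matrix_i h (e i)).
Proof.
move=> ch; set W := rowspan _.
have eW i : h (e i) \in W.
  by have -> : h (e i) = row i (\matrix_i h (e i)); [rewrite rowK | apply: row_rowspan].
have [m] := ubnP #|[set j in [set: 'I_n] | x 0 j != 0]|.
elim: m x => // m IH x; rewrite ltnS => lm x0.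
have [j xj] := res_neq0P x0.
have [i /andP[ij xi] | none] := pickP [pred i | (i != j) && (x 0 i != 0)].
  set y := x - x 0 i *: e i.
  have yj : red K (y 0 j) != 0 by rewrite drop_coord [j == i]eq_sym (negPf ij).
  have y0 := res_neq0 yj.
  have yW := IH y (leq_trans (support_drop (in_setT i) xi) lm) y0.
  have [|a [b ->]] := col_line ch (far_e yj ij) x0.
    by exists 1, (x 0 i); rewrite scale1r subrK.
  apply: rowspan_closed => //; rewrite -[_ *: _]addr0; apply: rowspan_closed => //.
  by apply/rowspanP; exists 0; rewrite mul0mx.
have ex : x = x 0 j *: e j.
  apply/rowP=> i; rewrite mxE eE; have := none i; rewrite /= [j == i]eq_sym.
  by case: eqVneq => [-> _ | _ /= /negbFE/eqP ->]; rewrite ?mulr1 ?mulr0.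
have /pointP[a] : h (x 0 j *: e j) \in rowspan (h (e j)).
  by apply: (col_point ch); rewrite ?e_neq0 ?unitr_red.
rewrite -ex => ->; rewrite -[_ *: _]addr0; apply: rowspan_closed => //.
by apply/rowspanP; exists 0; rewrite mul0mx.
Qed.

Hypothesis nat_gen : forall x : K, exists m : nat, x = m%:R.

Section Normalized.

Variable h : 'rV[K]_n -> 'rV[K]_n.
Hypothesis ch : collineation h.
Hypothesis he : forall i, exists2 c : K, c \is a GRing.unit & h (e i) = c *: e i.
Hypothesis heo : forall i, i != o ->
  exists2 c : K, c \is a GRing.unit & h (e o + e i) = c *: (e o + e i).

(* The affine coordinate on the line through e_o and e_i induced by h. *)
Let s i (t : K) := h (e o + t *: e i) 0 i / h (e o + t *: e i) 0 o.

Lemma affine_neq0 x : x 0 o = 1 -> x^r != 0.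
Proof. by move=> xo; apply: (@res_neq0 _ o); rewrite xo rmorph1 oner_eq0. Qed.

Lemma affine_far x i : x 0 o = 1 -> i != o -> far x (e i).
Proof. by move=> xo; apply: far_e; rewrite xo rmorph1 oner_eq0. Qed.

(** [x] is on the line joining the erased point to the fixed point [e i], so the two images are
    proportional away from coordinate i. The factor is a unit because [h x] is independent of
    [h (e i)]. *)
Lemma image_drop x i : i != o -> x 0 o = 1 ->
  exists2 a : K, a \is a GRing.unit &
    forall j, j != i -> h x 0 j = a * h (x - x 0 i *: e i) 0 j.
Proof.
move=> io xo; set y := x - _.
have yo : y 0 o = 1 by rewrite drop_coord [o == i]eq_sym (negPf io).
have fy := affine_far yo io; have fx := affine_far xo io.
have [|a [b hx]] := col_line ch fy (affine_neq0 xo).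
  by exists 1, (x 0 i); rewrite scale1r subrK.
exists a; first exact: far_comb (far_sym (col_far ch fx)) hx.
move=> j ji; have [c _ hi] := he i.
by rewrite hx hi !mxE eqxx (negPf ji) !mulr0 addr0.
Qed.

(** Each ratio depends on its own coordinate alone: erasing another coordinate leaves it unchanged,
    until the point is e_o + x_i e_i, where the ratio is [s] by definition. *)
Lemma image_affine x : x 0 o = 1 ->
  h x 0 o \is a GRing.unit /\ forall i, i != o -> h x 0 i / h x 0 o = s i (x 0 i).
Proof.
have ho : e o = e o + 0 by rewrite addr0.
have [m] := ubnP #|[set j in [set~ o] | x 0 j != 0]|.
elim: m x => // m IH x; rewrite ltnS => lm xo.
have base i : i != o -> (forall j, j != o -> j != i -> x 0 j = 0) ->
    x = e o + x 0 i *: e i.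
  move=> io x0; apply/rowP=> j; rewrite !mxE !eqxx /=.
  have [-> | jo] := eqVneq j o; first by rewrite xo eq_sym (negPf io) mulr0 addr0.
  have [-> | ji] := eqVneq j i; first by rewrite mulr1 add0r.
  by rewrite x0 // mulr0 addr0.
have [i /andP[io xi] | none] := pickP [pred i | (i != o) && (x 0 i != 0)]; last first.
  have x0 j : j != o -> x 0 j = 0 by move=> jo; have := none j; rewrite /= jo => /negbFE/eqP.
  have xe : x = e o.
    by apply/rowP=> j; rewrite eE; case: eqVneq => [<- | jo]; rewrite ?xo // x0 // eq_sym.
  split=> [|i io]; last by rewrite /s -base // => j jo _; apply: x0.
  by have [c uc hc] := he o; rewrite xe hc mxE eE eqxx mulr1.
have drop k : k != o -> x 0 k != 0 -> h x 0 o \is a GRing.unit /\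
    forall l, l != o -> l != k -> h x 0 l / h x 0 o = s l (x 0 l).
  move=> ko xk; have [a ua ha] := image_drop ko xo; set y := x - _ in ha.
  have yo : y 0 o = 1 by rewrite drop_coord [o == k]eq_sym (negPf ko).
  have [|uy ry] := IH y _ yo.
    by apply: leq_trans lm; apply: support_drop; rewrite ?inE.
  have ok : o != k by rewrite eq_sym.
  split=> [|l lo lk]; first by rewrite (ha o ok) unitrM ua.
  rewrite (ha o ok) (ha l lk) invrM // [_^-1 * _]mulrC mulrACA divrr // mul1r ry //.
  by rewrite drop_coord (negPf lk).
have [uo ri] := drop i io xi; split=> // l lo.
have [-> {l lo} | li] := eqVneq l i; last exact: ri.
have [k /and3P[ko ki xk] | none] := pickP [pred k | [&& k != o, k != i & x 0 k != 0]].
  by have [_ rk] := drop k ko xk; apply: rk; rewrite // eq_sym.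
rewrite /s -base // => j jo ji; apply/eqP.
by have := none j; rewrite /= jo ji => /negbFE.
Qed.

Lemma s0 i : i != o -> s i 0 = 0.
Proof.
move=> io; rewrite /s scale0r addr0; have [c _ ->] := he o.
by rewrite mxE eE eq_sym (negPf io) mulr0 mul0r.
Qed.

Lemma s1 i : i != o -> s i 1 = 1.
Proof.
move=> io; rewrite /s scale1r; have [c uc ->] := heo io.
rewrite !mxE !eqxx [o == i]eq_sym (negPf io) /= add0r addr0 divrr //.
by rewrite mulr1.
Qed.

(** e_i - e_j lies on the line of e_i and e_j and on that of e_o + e_i and e_o + e_j, which are all
    fixed points; the two image lines share only its multiples. *)
Lemma image_diff i j : i != o -> j != o -> i != j ->
  exists c : K, h (e i - e j) = c *: (e i - e j).
Proof.
move=> io jo ij; have ji : j != i by rewrite eq_sym.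
have fij : far (e i) (e j).
  by apply: (@far_e _ _ i); rewrite // eE eqxx rmorph1 oner_eq0.
have d0 : (e i - e j)^r != 0.
  by apply: (@res_neq0 _ i); rewrite !mxE !eqxx (negPf ij) subr0 rmorph1 oner_eq0.
have f2 : far (e o + e i) (e o + e j).
  apply: (@far_coord _ _ _ _ i).
  - by rewrite !mxE !eqxx (negPf io) add0r rmorph1 oner_eq0.
  - by rewrite !mxE !eqxx (negPf io) (negPf ij) add0r rmorph0.
  - apply: (@res_neq0 _ o).
    by rewrite !mxE !eqxx [o == j]eq_sym (negPf jo) addr0 rmorph1 oner_eq0.
have [|a [b hd]] := col_line ch fij d0.
  by exists 1, (-1); rewrite scale1r scaleN1r.
have [|a' [b' hd']] := col_line ch f2 d0.
  by exists 1, (-1); rewrite scale1r scaleN1r opprD addrACA subrr add0r.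
have [ci _ hi] := he i; have [cj _ hj] := he j.
have [c1 _ h1] := heo io; have [c2 _ h2] := heo jo.
rewrite hi hj !scalerA in hd; rewrite h1 h2 !scalerA in hd'.
have e2 := etrans (esym hd) hd'; exists (a * ci).
have Eo := congr1 (fun v : 'rV_n => v 0 o) e2; have Ei := congr1 (fun v : 'rV_n => v 0 i) e2.
have Ej := congr1 (fun v : 'rV_n => v 0 j) e2.
move: Eo Ei Ej; rewrite !mxE !eqxx [o == i]eq_sym [o == j]eq_sym [j == i]eq_sym.
rewrite (negPf io) (negPf jo) (negPf ij) /= !(mulr0, mulr1, addr0, add0r).
move=> Eo Ei Ej; rewrite hd scalerBr; congr (_ + _).
by rewrite -scaleNr; congr (_ *: _); rewrite Ej Ei; apply/eqP; rewrite -addr_eq0 addrC -Eo.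
Qed.

(* In affine coordinates e_o + u e_i + v e_j lies on the line joining
   e_o + (u + v) e_i to the fixed point e_i - e_j at infinity. *)
Lemma s_add i j (u v : K) : i != o -> j != o -> i != j -> s i u + s j v = s i (u + v).
Proof.
move=> io jo ij; pose x := e o + (u + v) *: e i; pose w := e o + u *: e i + v *: e j.
have [c hd] := image_diff io jo ij.
have xE k : x 0 k = if k == o then 1 else if k == i then u + v else 0.
  rewrite !mxE !eqxx /=; have [-> | ko] := eqVneq k o.
    by rewrite [o == i]eq_sym (negPf io) mulr0 addr0.
  by rewrite add0r; case: eqP; rewrite ?mulr1 ?mulr0.
have wE k : w 0 k = if k == o then 1 else if k == i then u else if k == j then v else 0.
  rewrite !mxE !eqxx /=; have [-> | ko] := eqVneq k o.
    by rewrite [o == i]eq_sym (negPf io) [o == j]eq_sym (negPf jo) !mulr0 !addr0.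
  have [-> | ki] := eqVneq k i; first by rewrite (negPf ij) mulr1 mulr0 add0r addr0.
  by rewrite mulr0 !add0r; case: eqP; rewrite ?mulr1 ?mulr0.
have xo : x 0 o = 1 by rewrite xE eqxx.
have wo : w 0 o = 1 by rewrite wE eqxx.
have [ux rx] := image_affine xo; have [uw rw] := image_affine wo.
have f : far x (e i - e j).
  apply: (@far_coord _ _ _ _ o); first by rewrite mxE xo rmorph1 oner_eq0.
    by rewrite !mxE !eqxx [o == i]eq_sym (negPf io) [o == j]eq_sym (negPf jo) subr0 rmorph0.
  apply: (@res_neq0 _ i).
  by rewrite !mxE !eqxx (negPf ij) subr0 rmorph1 oner_eq0.
have [|a [b hw]] := col_line ch f (affine_neq0 wo).
  exists 1, (- v); rewrite scale1r scalerBr scaleNr /x /w scalerDl.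
  by rewrite scaleNr opprK !addrA addrK.
rewrite hd scalerA in hw.
have := congr1 (fun z : 'rV_n => z 0 o) hw; have := congr1 (fun z : 'rV_n => z 0 i) hw.
have := congr1 (fun z : 'rV_n => z 0 j) hw.
rewrite !mxE !eqxx [o == i]eq_sym [o == j]eq_sym [j == i]eq_sym.
rewrite (negPf io) (negPf jo) (negPf ij) /= !(subrr, mulr0, mulr1, addr0, add0r, sub0r, subr0).
move=> Hj Hi Ho.
have hxj : h x 0 j = 0.
  have := rx j jo; rewrite xE (negPf jo) [j == i]eq_sym (negPf ij) s0 //.
  move=> /(congr1 ( *%R^~ (h x 0 o))).
  by rewrite mulrVK // mul0r.
rewrite hxj mulr0 add0r in Hj.
have wi := rw i io; have wj := rw j jo; have xi := rx i io.
rewrite wE (negPf io) eqxx in wi; rewrite wE (negPf jo) [j == i]eq_sym (negPf ij) eqxx in wj.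
rewrite xE (negPf io) eqxx in xi.
(* In the sum of coordinates i and j the point at infinity cancels, leaving the ratio for [x]. *)
rewrite -wi -wj -xi -mulrDl Hi Hj mulrN1 addrK Ho.
have ua : a \is a GRing.unit by move: uw; rewrite Ho unitrM => /andP[].
by rewrite invrM // [_^-1 * _]mulrC mulrACA divrr // mul1r.
Qed.

(** Taking u = 0 in [s_add] shows that s_i and s_j agree, so s_i is additive; it fixes 1, and every
    element is a sum of ones. The auxiliary index j exists since n >= 3. *)
Lemma s_id i t : i != o -> s i t = t.
Proof.
move=> io; have [j /andP[jo ji]] := third_index o i.
have ij : i != j by rewrite eq_sym.
have sij (v : K) : s j v = s i v by have := s_add 0 v io jo ij; rewrite s0 // !add0r.
have [m ->] := nat_gen t; elim: m => [|m IH]; first exact: s0.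
by rewrite -natr1 -(s_add _ _ io jo ij) IH sij s1.
Qed.

Lemma fixed_affine x : red K (x 0 o) != 0 -> exists a : K, h x = a *: x.
Proof.
move=> xo; have ux : x 0 o \is a GRing.unit by rewrite unitr_red.
pose y := (x 0 o)^-1 *: x; have yo : y 0 o = 1 by rewrite mxE mulVr.
have xy : x = x 0 o *: y by rewrite scalerA mulrV // scale1r.
have [uh rh] := image_affine yo.
have hy : h y = h y 0 o *: y.
  apply/rowP=> i; rewrite [RHS]mxE; have [-> | io] := eqVneq i o; first by rewrite yo mulr1.
  by rewrite -[y 0 i](s_id _ io) -rh // mulrC mulrVK.
have /pointP[a] := col_point ch (affine_neq0 yo) ux; rewrite -xy => ->.
by rewrite hy; exists (a * h y 0 o / x 0 o); rewrite /y !scalerA.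
Qed.

(** If x_o is not a unit, [x] is on the line of the fixed points [y] and x + y for suitable affine
    [y]. Two choices of [y] give two lines through [x] that contain [h x] and share only multiples
    of [x]. *)
Lemma fixed_point x : x^r != 0 -> exists a : K, h x = a *: x.
Proof.
move=> x0; have [xo | nxo] := eqVneq (red K (x 0 o)) 0; last exact: fixed_affine.
have [j xj] := res_neq0P x0.
have jo : j != o by apply: contraNneq xj => ->; rewrite xo.
have [k /andP[ko kj]] := third_index o j.
have ux : x 0 j \is a GRing.unit by rewrite unitr_red.
have line y : y 0 o = 1 -> y 0 j = 0 -> exists a b : K, h x = a *: x + b *: y.
  move=> yo yj; have y0 := affine_neq0 yo.
  have fxy : far (x + y) y.
    apply: (@far_coord _ _ _ _ j); rewrite ?y0 // mxE ?yj ?rmorph0 //.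
    by rewrite mxE yj addr0.
  have [|c1 h1] := @fixed_affine (x + y).
    by rewrite mxE rmorphD /= xo add0r yo rmorph1 oner_eq0.
  have [|c2 h2] := @fixed_affine y; first by rewrite yo rmorph1 oner_eq0.
  have [|a [b hx]] := col_line ch fxy x0.
    by exists 1, (-1); rewrite scale1r scaleN1r addrK.
  exists (a * c1), (a * c1 + b * c2).
  by rewrite hx h1 h2 !scalerA scalerDr -addrA -scalerDl.
have [||a [b h1]] := line (e o); rewrite ?eE ?eqxx ?[o == j]eq_sym ?(negPf jo) //.
have [||a' [b' h2]] := line (e o + e k).
- by rewrite mxE !eE eqxx (negPf ko) addr0.
- by rewrite mxE !eE [o == j]eq_sym (negPf jo) (negPf kj) addr0.
have E := etrans (esym h1) h2.
have Ej := congr1 (fun v : 'rV_n => v 0 j) E; have Ek := congr1 (fun v : 'rV_n => v 0 k) E.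
move: Ej Ek; rewrite !mxE !eqxx [j == o](negPf jo) [k == o](negPf ko).
rewrite [j == k]eq_sym (negPf kj) /= !(mulr0, addr0, mulr1, add0r).
move=> /(mulIr ux) -> /esym/eqP; rewrite -subr_eq0 addrAC subrr add0r => /eqP b0.
by exists a'; rewrite h2 b0 scale0r addr0.
Qed.

End Normalized.

End Fundamental.

Section Lines.

Variables (K : chainRing) (n : nat).
Hypothesis n3 : (2 < n)%N.
Hypothesis nat_gen : forall x : K, exists m : nat, x = m%:R.
Implicit Types x y : 'rV[K]_n.

Lemma unitmx_neq0 x (V : 'M[K]_n) : V \in unitmx -> x^r != 0 -> (x *m V)^r != 0.
Proof.
move=> uV; apply: contraNneq => xV0.
by rewrite -[x](mulmxK uV) map_mxM xV0 mul0mx.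
Qed.

Lemma collineation_mul h (V : 'M[K]_n) : V \in unitmx -> collineation h ->
  collineation (fun x => h x *m V).
Proof.
move=> uV ch; split=> [x x0 | x y fxy | x y w fxy w0 wE | x a x0 ua].
- by rewrite unitmx_neq0 ?(col_neq0 ch).
- have /andP[hx0 nhyx] := col_far ch fxy; rewrite /far unitmx_neq0 //=.
  apply: contra nhyx => /(submxMr (invmx V)^r).
  by rewrite -!map_mxM !mulmxK.
- have [a [b ->]] := col_line ch fxy w0 wE; exists a, b.
  by rewrite mulmxDl !scalemxAl.
- have /pointP[b ->] := col_point ch x0 ua; apply/pointP; exists b.
  by rewrite scalemxAl.
Qed.

(** The rows of [U] represent the images of the e_i, rescaled by [d i] so that the sum of rows o and
    i represents the image of e_o + e_i. Then [h] followed by the inverse of [U] fixes this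
    frame. *)
Theorem fundamental_theorem (f g : {set 'rV[K]_n} -> {set 'rV[K]_n}) :
  permutes_subspaces 2 f -> permutes_subspaces 1 g ->
  (forall P X, is_subspace 1 P -> is_subspace 2 X -> (g P \subset f X) = (P \subset X)) ->
  exists2 U : 'M[K]_n, U \in unitmx & forall P, is_subspace 1 P -> g P = mulS U P.
Proof.
move=> pf pg inc; have [h ch gh] := collineation_exists n3 pf pg inc.
pose o := Ordinal (ltnW (ltnW n3)); pose e i : 'rV[K]_n := delta_mx 0 i.
have dex i : exists d : K, d \is a GRing.unit /\
    if i == o then d = 1 else exists2 a : K, a \is a GRing.unit &
      h (e o + e i) = a *: (h (e o) + d *: h (e i)).
  have [_ | io] := eqVneq i o; first by exists 1; rewrite unitr1.
  have oi : o != i by rewrite eq_sym.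
  have one : red K (e o 0 o) != 0 by rewrite eE eqxx rmorph1 oner_eq0.
  have ooi : red K ((e o + e i) 0 o) != 0.
    by rewrite mxE !eE eqxx (negPf io) addr0 rmorph1 oner_eq0.
  have ioi : red K ((e o + e i) 0 i) != 0.
    by rewrite mxE !eE eqxx (negPf oi) add0r rmorph1 oner_eq0.
  have [|a [b hE]] := col_line ch (far_e one io) (res_neq0 ooi).
    by exists 1, 1; rewrite !scale1r.
  have ua : a \is a GRing.unit := far_comb (far_sym (col_far ch (far_e ooi io))) hE.
  have ub : b \is a GRing.unit.
    apply: (far_comb (far_sym (col_far ch (far_e ioi oi))) (b := a)).
    by rewrite hE addrC.
  exists (b / a); split; first by rewrite unitrM ub unitrV.
  by exists a; rewrite // scalerDr scalerA mulrCA divrr // mulr1.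
have [d dP] := fin_all_exists dex.
pose U : 'M[K]_n := \matrix_i (d i *: h (e i)).
have eU i : e i *m U = d i *: h (e i) by rewrite -rowE rowK.
have hU i : h (e i) = (d i)^-1 *: (e i *m U).
  by rewrite eU scalerA mulVr ?scale1r //; case: (dP i).
have spanU x : x^r != 0 -> h x \in rowspan U.
  move=> x0; have := image_in_span ch x0; apply/subsetP.
  have cU := rowspan_closed (A := U).
  have U0 : 0 \in rowspan U by apply/rowspanP; exists 0; rewrite mul0mx.
  apply/(rowspan_subP _ cU U0) => i; rewrite rowK hU -[_ *: _]addr0.
  by apply: cU => //; apply: mem_rowspan.
have uU : U \in unitmx.
  (* Surjectivity of [g] on points puts every e_i into the row span of [U]. *)
  have [E /esym/mulmx1_unit[]//] : exists E, 1%:M = E *m U.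
  apply: rowspan_sub_factor; have cU := rowspan_closed (A := U).
  have U0 : 0 \in rowspan U by apply/rowspanP; exists 0; rewrite mul0mx.
  apply/(rowspan_subP _ cU U0) => i; rewrite row1.
  have [P sP gP] := permutes_surj pg (point_subspace (e_neq0 K i)).
  have /subspaceP[x ux eP] := sP.
  have x0 : x^r != 0.
    by rewrite -mxrank_eq0 -lt0n; move: ux; rewrite unimodular_red -row_leq_rank.
  have : e i \in rowspan (h x) by rewrite -gh // -eP gP mem_point.
  case/pointP=> c ec; rewrite -/(e i) ec -[_ *: _]addr0; apply: cU => //.
  exact: spanU.
exists U => // P sP; have /subspaceP[x ux eP] := sP.
have x0 : x^r != 0.
  by rewrite -mxrank_eq0 -lt0n; move: ux; rewrite unimodular_red -row_leq_rank.
have uV : invmx U \in unitmx by rewrite unitmx_inv.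
have [|i io|a ha] := @fixed_point _ _ o n3 nat_gen _ (collineation_mul uV ch) _ _ x x0.
- move=> i; exists (d i)^-1; first by rewrite unitrV; case: (dP i).
  by rewrite hU -scalemxAl mulmxK.
- have [_] := dP i; rewrite (negPf io) => -[a ua hE]; exists a => //.
  have do1 : d o = 1 by have [_] := dP o; rewrite ?eqxx.
  by rewrite hE -scalemxAl hU do1 invr1 scale1r -eU -mulmxDl mulmxK.
rewrite eP mulS_rowspan gh //; apply: point_eq.
- exact: unitmx_neq0.
- exact: col_neq0.
apply/pointP; exists a.
by rewrite scalemxAl -ha mulmxKV.
Qed.

(** Descends to the points, then lifts [U] back. After one descent n exceeds twice the rank, so
    [star_image] leaves no room for tops and [g] again preserves stars. *)
Lemma star_preserving_linear k (f : {set 'rV[K]_n} -> {set 'rV[K]_n}) : (k.+2 <= n - k.+2)%N ->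
  adj_aut k.+1 f -> preserves_stars k.+1 f ->
  exists2 U : 'M[K]_n, U \in unitmx & forall X, is_subspace k.+2 X -> f X = mulS U X.
Proof.
elim: k f => [|k IH] f kn [pf af] fs.
  have [|g pg inc] := star_map pf fs; first by lia.
  have [U uU gU] := fundamental_theorem pf pg inc.
  by exists U => //; apply: mulS_lift uU pf inc gU.
have [|g pg inc] := star_map pf fs; first by lia.
have ag : adj_aut k.+1 g by apply: star_map_adj pf pg _ inc; lia.
have kn1 : (k.+2 <= n - k.+2)%N by lia.
have gs : preserves_stars k.+1 g.
  have nk : n <> k.+2.*2 by lia.
  by move=> P sP; have [//| [/nk[]]] := star_image ag isT kn1 sP.
have [U uU gU] := IH g kn1 ag gs.
by exists U => //; apply: (mulS_lift uU pf inc gU).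
Qed.

End Lines.

(** * The rings of integers modulo a prime power *)

Section IntegersModPrimePower.

Variables (p s : nat).
Hypotheses (p_prime : prime p) (s_ge1 : (1 <= s)%N).

Let q_gt1 : (1 < p ^ s)%N.
Proof. by rewrite -(expn0 p) ltn_exp2l ?prime_gt1. Qed.

Lemma natr_Fp_mod k : (k %% p ^ s)%:R = k%:R :> 'F_p.
Proof.
rewrite [in RHS](divn_eq k (p ^ s)) natrD natrM natrX pchar_Fp_0 //.
by case: s s_ge1 => // t _; rewrite expr0n mulr0 add0r.
Qed.

Definition Zp_red (x : 'Z_(p ^ s)) : 'F_p := (x : nat)%:R.

Lemma Zp_red_nat k : Zp_red k%:R = k%:R.
Proof. by rewrite /Zp_red val_Zp_nat // natr_Fp_mod. Qed.

Lemma Zp_red_nmod : nmod_morphism Zp_red.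
Proof.
split=> [|x y]; first by rewrite -[0]/(0%:R) Zp_red_nat.
by rewrite -[x]natr_Zp -[y]natr_Zp -natrD !Zp_red_nat natrD.
Qed.

Lemma Zp_red_monoid : monoid_morphism Zp_red.
Proof.
split=> [|x y]; first by rewrite -[1]/(1%:R) Zp_red_nat.
by rewrite -[x]natr_Zp -[y]natr_Zp -natrM !Zp_red_nat natrM.
Qed.

HB.instance Definition _ := GRing.isNmodMorphism.Build _ _ Zp_red Zp_red_nmod.
HB.instance Definition _ := GRing.isMonoidMorphism.Build _ _ Zp_red Zp_red_monoid.

Lemma Zp_red_eq0 x : (Zp_red x == 0) = (p %| x)%N.
Proof. by rewrite (dvdn_pcharf (pchar_Fp p_prime)). Qed.

Definition Zp_lift (y : 'F_p) : 'Z_(p ^ s) := (y : nat)%:R.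

Lemma Zp_liftK : cancel Zp_lift Zp_red.
Proof. by move=> y; rewrite Zp_red_nat natr_Zp. Qed.

Lemma Zp_red_unit x : Zp_red x != 0 -> x \is a GRing.unit.
Proof.
rewrite Zp_red_eq0 -prime_coprime // => cpx.
by rewrite -[x]natr_Zp unitZpE // coprimeXl.
Qed.

Lemma Zp_red_eq0_dvd x : Zp_red x = 0 -> exists y, x = p%:R * y.
Proof.
move=> /eqP; rewrite Zp_red_eq0 => px; exists (x %/ p)%:R.
by rewrite -natrM mulnC divnK // natr_Zp.
Qed.

Lemma Zp_unif_nilp : p%:R ^+ s = 0 :> 'Z_(p ^ s).
Proof. by rewrite -natrX; apply: val_inj; rewrite /= val_Zp_nat // modnn. Qed.

Definition Zp_chain : chainRing :=
  @ChainRing 'Z_(p ^ s) p p_prime Zp_red Zp_lift Zp_liftK Zp_red_unit p%:R s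
    Zp_red_eq0_dvd Zp_unif_nilp.

End IntegersModPrimePower.

(** * From automorphisms of the graph to maps of subspaces *)

Section Chow.

Variables (K : chainRing) (n k : nat).
Implicit Types X Y : {set 'rV[K]_n}.

Lemma meetsE X Y : is_subspace k.+1 X -> is_subspace k.+1 Y ->
  meets k X Y <-> (X == Y) || (Defs.dim (X :&: Y) == k).
Proof.
move=> sX sY; split=> [mXY | /orP[/eqP <- | /(adjP sX sY)[_ //]]].
  by case: eqVneq => //= nXY; apply/(adjP sX sY).
by have [P sP PX] := exists_sub sX (leqnSn k); exists P.
Qed.

Variable phi : grassmann_vertex K n k.+1 -> grassmann_vertex K n k.+1.
Hypothesis phi_aut : grassmann_automorphism phi.

(** Carries [phi] from the type of vertices to all sets, where it can be composed with [dual]. *)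
Definition vertex_map X : {set 'rV[K]_n} :=
  if insub X is Some v then val (phi v) else X.

Lemma vertex_map_val v : vertex_map (val v) = val (phi v).
Proof. by rewrite /vertex_map valK. Qed.

Lemma vertex_map_adj_aut : adj_aut k vertex_map.
Proof.
have [/bij_inj phi_inj phi_adj] := phi_aut.
have ex X (sX : is_subspace k.+1 X) : exists v : grassmann_vertex K n k.+1, val v = X.
  by exists (Sub X sX); rewrite SubK.
split; first split=> [X /ex[v <-] | X Y /ex[v <-] /ex[w <-]].
- by rewrite vertex_map_val; apply: valP.
- by rewrite !vertex_map_val => /val_inj/phi_inj ->.
move=> X Y /ex[v <-] /ex[w <-]; rewrite !vertex_map_val.
have adj := phi_adj v w; rewrite /grassmann_adj /= in adj.
have eqE : (val (phi v) == val (phi w)) = (val v == val w).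
  by rewrite !(inj_eq val_inj) (inj_eq phi_inj).
by rewrite !meetsE ?valP // adj eqE.
Qed.

Theorem chow : (1 <= k)%N -> (2 * k.+1 <= n)%N ->
  (forall x : K, exists j : nat, x = j%:R) ->
  (exists U : 'M[K]_n, U \in unitmx /\
     forall (X : grassmann_vertex K n k.+1) (M : 'M[K]_(k.+1, n)),
       represents M (val X) -> val (phi X) = rowspan (M *m U))
  \/
  (n = (2 * k.+1)%N /\
   exists U : 'M[K]_n, U \in unitmx /\
     forall (X : grassmann_vertex K n k.+1) (M : 'M[K]_(k.+1, n)),
       represents M (val X) -> val (phi X) = dual (rowspan (M *m U))).
Proof.
move=> k1 kn nat_gen; have af := vertex_map_adj_aut.
have n3 : (2 < n)%N by lia.
have kn' : (k.+1 <= n - k.+1)%N by lia.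
have linear g : adj_aut k g -> preserves_stars k g -> exists2 U : 'M[K]_n,
    U \in unitmx & forall X, is_subspace k.+1 X -> g X = mulS U X.
  case: (k) k1 kn' => // j _ jn ag gs.
  exact: (star_preserving_linear n3 nat_gen jn ag gs).
have [nk | nk] := eqVneq n (k.+1.*2).
  have [fs | ft] := stars_or_tops af k1 nk; [left | right].
    have [U uU fU] := linear _ af fs; exists U; split=> // X M /and3P[_ _ /eqP eX].
    by rewrite -vertex_map_val fU ?valP // eX mulS_rowspan.
  split; first by rewrite nk mul2n.
  have gs := dual_preserves_stars nk af.1 ft.
  have [U uU fU] := linear _ (dual_adj_aut nk af) gs.
  exists U; split=> // X M /and3P[_ _ /eqP eX].
  (* [U] was found for the dual of [phi]; dualizing once more recovers [phi]. *)
  rewrite -mulS_rowspan -eX -fU ?valP // vertex_map_val.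
  by rewrite (dualK (valP (phi X))).
have fs : preserves_stars k vertex_map.
  move=> P sP; have [//|[nk' _]] := star_image af k1 kn' sP.
  by rewrite nk' eqxx in nk.
have [U uU fU] := linear _ af fs; left; exists U; split=> // X M /and3P[_ _ /eqP eX].
by rewrite -vertex_map_val fU ?valP // eX mulS_rowspan.
Qed.

End Chow.

Theorem theorem5p1 (p s n m : nat) (p_prime : prime p) (s_ge1 : (1 <= s)%N)
    (m_ge : (4 <= 2 * m)%N) (n_ge : (2 * m <= n)%N)
    (phi : grassmann_vertex 'Z_(p ^ s) n m -> grassmann_vertex 'Z_(p ^ s) n m)
    (phi_aut : grassmann_automorphism phi) :
  (exists U : 'M['Z_(p ^ s)]_n, U \in unitmx /\
     forall (X : grassmann_vertex 'Z_(p ^ s) n m) (M : 'M['Z_(p ^ s)]_(m, n)),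
       represents M (val X) -> val (phi X) = rowspan (M *m U))
  \/
  (n = (2 * m)%N /\
   exists U : 'M['Z_(p ^ s)]_n, U \in unitmx /\
     forall (X : grassmann_vertex 'Z_(p ^ s) n m) (M : 'M['Z_(p ^ s)]_(m, n)),
       represents M (val X) -> val (phi X) = dual (rowspan (M *m U))).
Proof.
case: m m_ge n_ge phi phi_aut => [|k] // m_ge n_ge phi phi_aut.
apply: (@chow (Zp_chain p_prime s_ge1) n k phi phi_aut) => [||x] //; first by lia.
by exists x; rewrite natr_Zp.
Qed.
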